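(* Let $m\ge 2$ be an integer, let $w$ be an infinite periodic or Sturmian word over $\{0,1\}$ with slope $\alpha=\pi(w)$, and let $A=A(m,w)=A_0\oplus A_1$ carry the $\mathbb{Z}_2$-grading in which $a,z_1^{(1)}\in A_0$ and $b\in A_1$. Then the graded PI-exponent $\exp^{gr}(A)$ exists and $$\exp^{gr}(A)=\exp(A)=\Phi\Big(\frac{1}{m+\alpha}\Big).$$
   Context: $F$ is a field of characteristic zero; algebras are nonassociative. For integers $k_i\ge 2$, $A(K)$ is the algebra with basis $\{a,b,z_j^{(i)}: i\ge1, 1\le j\le k_i\}$ and multiplication $z_j^{(i)}a=z_{j+1}^{(i)}$ ($1\le j<k_i$), $z_{k_i}^{(i)}b=z_1^{(i+1)}$, all other products of basis elements zero. For an integer $m\ge2$ and an infinite word $w=w_1w_2\cdots$ over $\{0,1\}$, $A(m,w)$ is $A(K)$ with $k_i=m+w_i$. It is generated by $z_1^{(1)},a,b$. The grading with $z_1^{(1)},a$ even and $b$ odd is: $A_0=\mathrm{span}\{a, z_j^{(i)}: i \text{ odd}\}$, $A_1=\mathrm{span}\{b,z_j^{(i)}: i\text{ even}\}$. The complexity $\mathrm{Comp}_w(n)$ is the number of distinct length-$n$ subwords of $w$; $w$ is Sturmian if $\mathrm{Comp}_w(n)=n+1$ for all $n\ge1$. The slope is $\pi(w)=\lim_{n\to\infty}(w_1+\dots+w_n)/n$ (it exists for periodic and Sturmian words). $\Phi(x)=x^{-x}(1-x)^{-(1-x)}$ for $0\le x\le1$. Ordinary codimensions: $c_n(A)=\dim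 P_n/(P_n\cap Id(A))$ with $P_n$ the multilinear polynomials of degree $n$ in the free nonassociative algebra, $\exp(A)=\lim\sqrt[n]{c_n(A)}$. Graded codimensions: in the free algebra $F\{X,Y\}$ with even generators $X$ and odd generators $Y$, a polynomial is a graded identity if it vanishes whenever even variables are replaced by elements of $A_0$ and odd by elements of $A_1$; $Id^{gr}(A)$ is the ideal of graded identities; $P_{k,n-k}$ is the space of polynomials multilinear in $x_1,\dots,x_k\in X$, $y_1,\dots,y_{n-k}\in Y$; $c_{k,n-k}(A)=\dim P_{k,n-k}/(P_{k,n-k}\cap Id^{gr}(A))$; $c_n^{gr}(A)=\sum_{k=0}^n\binom nk c_{k,n-k}(A)$; $\exp^{gr}(A)=\lim_{n\to\infty}\sqrt[n]{c_n^{gr}(A)}$ when the limit exists, with $\underline{\exp}^{gr},\overline{\exp}^{gr}$ the liminf and limsup. *)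

(* Defs.v *)
From Stdlib Require Import Reals ClassicalEpsilon.
From HB Require Import structures.
From mathcomp Require Import all_boot all_order all_algebra.
Set Implicit Arguments. Unset Strict Implicit. Unset Printing Implicit Defensive.
Import GRing.Theory.

Definition classicb (P : Prop) : bool :=
  if excluded_middle_informative P then true else false.

Inductive ntree := Leaf of nat | Node of ntree & ntree.

Fixpoint brackets (fuel : nat) (s : seq nat) : seq ntree :=
  match fuel with
  | 0 => [::]
  | fuel'.+1 =>
    match s with
    | [:: x] => [:: Leaf x]
    | _ => flatten [seq [seq Node l r | l <- brackets fuel' (take k s),
                                         r <- brackets fuel' (drop k s)]
                   | k <- iota 1 (size s).-1]
    end
  end.

(* The basis of P_n: all multilinear nonassociative monomials in the
   variables 0, ..., n-1 (each occurring exactly once); these are the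
   bracketings of all permutations of the variables. *)
Definition monomials (n : nat) : seq ntree :=
  flatten [seq brackets (size p) p | p <- permutations (iota 0 n)].

Definition Nmon (n : nat) : nat := size (monomials n).

(* K : nat -> nat, block i (0-based, i.e. paper's block i+1) has
   k_i = K i elements. The z's are listed consecutively with a global
   position p: block 0 occupies positions 0..K 0 - 1, etc.  An element
   alpha a + beta b + sum_p c_p z_p is stored as (alpha, beta, sum_p c_p X^p). *)

Record Aelt (F : fieldType) := mkA { acoef : F; bcoef : F; zpart : {poly F} }.

Section AlgebraA.
Variable F : fieldType.
Variable K : nat -> nat.
Local Open Scope ring_scope.

Definition A0 : Aelt F := mkA 0 0 0.
Definition Aadd (u v : Aelt F) : Aelt F :=
  mkA (acoef u + acoef v) (bcoef u + bcoef v) (zpart u + zpart v).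
Definition Ascale (c : F) (u : Aelt F) : Aelt F :=
  mkA (c * acoef u) (c * bcoef u) (c *: zpart u).

Definition bstart (i : nat) : nat := (\sum_(l < i) K l)%N.
Definition block_of (p : nat) : nat :=
  \big[maxn/0%N]_(i < p.+1 | leq (bstart i) p) (i : nat).
Definition is_last (p : nat) : bool := p.+1 == bstart (block_of p).+1.

(* multiplication: z_j^{(i)} a = z_{j+1}^{(i)} (j < k_i),
   z_{k_i}^{(i)} b = z_1^{(i+1)}, all other products of basis elements 0 *)
Definition Amul (u v : Aelt F) : Aelt F :=
  mkA 0 0 ('X * \poly_(p < size (zpart u))
                 ((zpart u)`_p * (if is_last p then bcoef v else acoef v))).

(* Z_2-grading: blocks with even 0-based index (odd in the paper) and a
   are even; b and the other blocks are odd. *)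
Definition in_A0 (u : Aelt F) : Prop :=
  bcoef u = 0 /\ forall p, odd (block_of p) -> (zpart u)`_p = 0.
Definition in_A1 (u : Aelt F) : Prop :=
  acoef u = 0 /\ forall p, ~~ odd (block_of p) -> (zpart u)`_p = 0.

Fixpoint eval_mon (sigma : nat -> Aelt F) (t : ntree) : Aelt F :=
  match t with
  | Leaf i => sigma i
  | Node l r => Amul (eval_mon sigma l) (eval_mon sigma r)
  end.

Definition eval_poly (n : nat) (f : 'rV[F]_(Nmon n)) (sigma : nat -> Aelt F)
  : Aelt F :=
  \big[Aadd/A0]_(t < Nmon n)
     Ascale (f 0 t) (eval_mon sigma (nth (Leaf 0) (monomials n) t)).

Definition is_id (n : nat) (f : 'rV[F]_(Nmon n)) : Prop :=
  forall sigma, eval_poly f sigma = A0.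

Definition is_grid (k n : nat) (f : 'rV[F]_(Nmon n)) : Prop :=
  forall sigma, (forall i, leq i.+1 k -> in_A0 (sigma i)) ->
                (forall i, leq k i -> leq i.+1 n -> in_A1 (sigma i)) ->
                eval_poly f sigma = A0.

(* dimension of the subspace {f in F^N | I f} (assumed to be a subspace):
   the largest rank of a matrix whose row space lies in it *)
Definition dim_sub (N : nat) (I : 'rV[F]_N -> Prop) : nat :=
  \big[maxn/0%N]_(r < N.+1 | classicb (exists U : 'M[F]_N,
        \rank U = r /\ forall v : 'rV[F]_N, (v <= U)%MS -> I v)) (r : nat).

Definition codim (n : nat) : nat := (Nmon n - dim_sub (@is_id n))%N.

Definition codim_gr (k n : nat) : nat := (Nmon n - dim_sub (@is_grid k n))%N.

Definition codim_gr_total (n : nat) : nat :=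
  (\sum_(k < n.+1) 'C(n, k) * codim_gr k n)%N.

End AlgebraA.

Definition Kmw (m : nat) (w : nat -> bool) : nat -> nat := fun i => (m + w i)%N.

(* an infinite word w_1 w_2 ... is w : nat -> bool with w_{i+1} = w i *)
Definition factor (w : nat -> bool) (k n : nat) : n.-tuple bool :=
  [tuple w (k + i)%N | i < n].

Definition Comp (w : nat -> bool) (n : nat) : nat :=
  #|[set t : n.-tuple bool | classicb (exists k, t = factor w k n)]|.

Definition sturmian (w : nat -> bool) : Prop :=
  forall n, (1 <= n)%N -> Comp w n = n.+1.

Definition periodic (w : nat -> bool) : Prop :=
  exists T, (0 < T)%N /\ forall i, w (i + T)%N = w i.

Open Scope R_scope.

Definition slope_is (w : nat -> bool) (alpha : R) : Prop :=
  Un_cv (fun n => INR (\sum_(i < n) (w i : nat))%N / INR n) alpha.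

Definition nroot (c n : nat) : R :=
  if (c == 0)%N then 0 else Rpower (INR c) (/ INR n).

(* Phi(x) = x^{-x} (1-x)^{-(1-x)}, with 0^0 = 1 *)
Definition xpow_negx (x : R) : R :=
  if Req_EM_T x 0 then 1 else Rpower x (- x).
Definition Phi (x : R) : R := xpow_negx x * xpow_negx (1 - x).

(* Main.v *)
Require Import Defs.
From Stdlib Require Import Reals.
From HB Require Import structures.
From mathcomp Require Import all_boot all_order all_algebra.
From Stdlib Require Import Lra.
From mathcomp Require Import zify.

(** In A(K) a monomial can be nonzero only if it is left-normed, and then it reads
a factor of the word v over {a, b} that spells out the blocks (b at the end of a
block).  A multilinear polynomial is an identity iff, for every factor u of v of
length n-1, every head variable h and every set T of variables, the coefficients
of the left-normed monomials with head h whose variables at the b-positions of u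
form T sum to zero.  Since v has polynomially many factors of each length, and the
number of b's in a factor of length n-1 is the number j(n) of b's in the prefix up
to a bounded error, both c_n and c_n^gr equal binomial(n, j(n)) up to a polynomial
factor, while j(n)/n tends to 1/(m + alpha).  In the graded case T is forced by h
and the parities, and the binomial coefficient comes from the sum over k.

Bounded discrepancy for Sturmian words is the classical fact that they are
balanced: a shortest unbalanced pair has the form 0u0, 1u1 with u a palindrome; one
of 0u, 1u, say cu, is the only right special factor of its length; it does not
occur in the window of length 2|u|+2 that starts with the other word, so by
pigeonhole the word would be eventually periodic. *)

(** * Balanced words *)

Lemma classicbP (P : Prop) : reflect P (classicb P).
Proof.
rewrite /classicb; case: ClassicalEpsilon.excluded_middle_informative => H.
  exact: ReflectT.
exact: ReflectF.
Qed.

Section WordCount.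
Local Open Scope nat_scope.

Definition wcount (w : nat -> bool) (i n : nat) : nat := \sum_(k < n) w (i + k).

Variable w : nat -> bool.

Lemma wcount0 i : wcount w i 0 = 0.
Proof. by rewrite /wcount big_ord0. Qed.

Lemma wcountSr i n : wcount w i n.+1 = wcount w i n + w (i + n).
Proof. by rewrite /wcount big_ord_recr. Qed.

Lemma wcountD i n k : wcount w i (n + k) = wcount w i n + wcount w (i + n) k.
Proof.
rewrite /wcount big_split_ord /=; congr (_ + _).
by apply: eq_bigr => l _; rewrite addnA.
Qed.

Lemma wcountSl i n : wcount w i n.+1 = w i + wcount w i.+1 n.
Proof. by rewrite -add1n wcountD wcountSr wcount0 add0n addn0 addn1. Qed.

Lemma wcount_leq i n : wcount w i n <= n.
Proof. by elim: n => [|n IH]; rewrite ?wcount0 // wcountSr; case: (w _); lia. Qed.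

Lemma leq_wcount i n k : n <= k -> wcount w i n <= wcount w i k.
Proof. by move=> /subnKC <-; rewrite wcountD leq_addr. Qed.

Lemma wcount_rev i n : wcount w i n = \sum_(k < n) w (i + (n - k.+1)).
Proof. by rewrite /wcount (reindex_inj rev_ord_inj). Qed.

Definition same_factor (n a b : nat) : Prop := forall l, l < n -> w (a + l) = w (b + l).

Lemma factor_eqP a b n : factor w a n = factor w b n <-> same_factor n a b.
Proof.
split=> [E l ln|E].
  by have := congr1 (fun t => tnth t (Ordinal ln)) E; rewrite !tnth_mktuple.
by apply: eq_from_tnth => l; rewrite !tnth_mktuple; apply: E.
Qed.

Lemma same_factor_sym n a b : same_factor n a b -> same_factor n b a.
Proof. by move=> E l ln; rewrite E. Qed.

Lemma same_factor_trans n a b c :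
  same_factor n a b -> same_factor n b c -> same_factor n a c.
Proof. by move=> E E' l ln; rewrite E // E'. Qed.

Lemma same_factor_shift n a b : same_factor n a b -> w (a + n) = w (b + n) ->
  same_factor n a.+1 b.+1.
Proof.
move=> E En l ln; rewrite !addSnnS.
by case: (ltngtP l.+1 n) => [h|h|->//]; [exact: E | lia].
Qed.

Definition factors n := [set t : n.-tuple bool | classicb (exists k, t = factor w k n)].

Lemma mem_factors n k : factor w k n \in factors n.
Proof. by rewrite inE; apply/classicbP; exists k. Qed.

Lemma factorsP n t : t \in factors n -> exists k, t = factor w k n.
Proof. by rewrite inE => /classicbP. Qed.

Definition chop n (t : n.+1.-tuple bool) : n.-tuple bool :=
  [tuple tnth t (widen_ord (leqnSn n) i) | i < n].

Lemma chop_factor n k : chop n (factor w k n.+1) = factor w k n.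
Proof. by apply: eq_from_tnth => l; rewrite !tnth_mktuple. Qed.

(** Chopping the last letter maps factors of length [n.+1] onto those of length [n]. With two
    different right special words the map stays onto after one extension of each is removed, so the
    complexity would grow by at least two. *)
Lemma right_special_uniq n a b c d : Comp w n.+1 <= (Comp w n).+1 ->
  same_factor n a b -> w (a + n) != w (b + n) ->
  same_factor n c d -> w (c + n) != w (d + n) -> same_factor n a c.
Proof.
move=> hC Eab Dab Ecd Dcd; apply/factor_eqP/eqP/negPn/negP => Dac.
set fa := factor w a n.+1; set fc := factor w c n.+1.
have Dfac : fa != fc.
  by apply/eqP => /(congr1 (chop n)); rewrite !chop_factor; apply/eqP.
have neq_last x y : w (x + n) != w (y + n) -> factor w y n.+1 != factor w x n.+1.
  by apply: contraNneq => /factor_eqP ->.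
have sub : factors n \subset chop n @: (factors n.+1 :\: [set fa; fc]).
  apply/subsetP => t /factorsP[k ->].
  suff [k' [Ek na nc]] : exists k', [/\ factor w k' n = factor w k n,
      factor w k' n.+1 != fa & factor w k' n.+1 != fc].
    apply/imsetP; exists (factor w k' n.+1); last by rewrite chop_factor.
    by rewrite !inE negb_or na nc /=; apply/classicbP; exists k'.
  have [Ea|Na] := eqVneq (factor w k n.+1) fa.
    exists b; split.
    - by rewrite -[RHS]chop_factor Ea chop_factor; apply/factor_eqP/same_factor_sym.
    - exact: neq_last.
    - apply/eqP => /(congr1 (chop n)); rewrite !chop_factor => E; move/eqP: Dac.
      by apply; rewrite -E; apply/factor_eqP.
  have [Ec|Nc] := eqVneq (factor w k n.+1) fc; last by exists k.
  exists d; split.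
  - by rewrite -[RHS]chop_factor Ec chop_factor; apply/factor_eqP/same_factor_sym.
  - apply/eqP => /(congr1 (chop n)); rewrite !chop_factor => E; move/eqP: Dac.
    by apply; rewrite -E; apply/factor_eqP/same_factor_sym.
  - exact: neq_last.
have := leq_trans (subset_leq_card sub) (leq_imset_card _ _).
have := cardsID [set fa; fc] (factors n.+1).
have /setIidPr -> : [set fa; fc] \subset factors n.+1.
  by apply/subsetP => t; rewrite !inE => /orP[]/eqP->; apply/classicbP; eexists.
rewrite cards2 Dfac /=.
move: hC; rewrite /Comp -!/(factors _) => h1 h2 h3; rewrite -h2 add2n ltnS in h1.
by have := leq_trans h1 h3; rewrite ltnn.
Qed.

(** Otherwise chopping the last letter would be injective on factors and the complexity could not
    grow. *)
Lemma right_special_ex n : Comp w n < Comp w n.+1 ->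
  exists a b, same_factor n a b /\ w (a + n) != w (b + n).
Proof.
move=> hC; apply/classicbP; apply: contraLR hC => /classicbP H.
rewrite -leqNgt /Comp -!/(factors _).
rewrite -(card_in_imset (f := chop n)).
  apply/subset_leq_card/subsetP => t /imsetP[_ /factorsP[k ->] ->].
  by rewrite chop_factor mem_factors.
move=> _ _ /factorsP[a ->] /factorsP[b ->]; rewrite !chop_factor => /factor_eqP E.
apply/factor_eqP => l; rewrite ltnS leq_eqVlt => /orP[/eqP->|]; last exact: E.
by apply/eqP/negPn/negP => D; case: H; exists a, b.
Qed.

(* The two windows of a shortest unbalanced pair read 0 u 0 and 1 u 1 with the
   same palindrome u. *)
Lemma min_unbalanced N i j :
  (forall n, n < N -> forall i j, wcount w i n <= (wcount w j n).+1) ->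
  wcount w i N + 2 <= wcount w j N ->
  exists n, [/\ N = n.+2, [/\ w i = false, w j, w (i + n.+1) = false & w (j + n.+1)],
    forall l, 0 < l <= n -> w (j + l) = w (i + l)
    & forall l, 0 < l <= n -> w (i + (n.+1 - l)) = w (i + l)].
Proof.
move=> IH H.
case: N IH H => [|[|n]] IH H; first by rewrite !wcount0 in H.
  by move: H; rewrite !wcountSr !wcount0; do 2!case: (w _).
(* By minimality each of the two pieces cut at [l] has excess at most one; the total is at least
   two, so each has excess exactly one. *)
have E l : 0 < l < n.+2 -> wcount w j l = (wcount w i l).+1.
  case/andP=> l0 ln.
  have e : n.+2 = l + (n.+2 - l) by lia.
  have := IH l ln j i; have := IH (n.+2 - l) ltac:(lia) (j + l) (i + l).
  move: H; rewrite e !wcountD -e; lia.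
have E1 := E 1 isT; rewrite !wcountSr !wcount0 !addn0 in E1.
have w_i : w i = false by move: E1; do 2!case: (w _).
have w_j : w j by move: E1; do 2!case: (w _).
have En := E n.+1 ltac:(lia).
rewrite !(wcountSr _ n.+1) in H.
have w_in : w (i + n.+1) = false by move: H En; do 2!case: (w _); lia.
have w_jn : w (j + n.+1) by move: H En; do 2!case: (w _); lia.
have M l : 0 < l <= n -> w (j + l) = w (i + l).
  move=> hl; have := E l.+1 ltac:(lia); rewrite !wcountSr E; last lia.
  by do 2!case: (w _); lia.
exists n; split => //.
(* The mirror symmetry known so far gives the last [l.+2] letters of one window and the first [l.+2]
   of the other inner blocks with equally many ones. Balance at this length then forces the two
   remaining inner letters to agree. *)
elim/ltn_ind => l IHl hl.
case: l hl IHl => // l /andP[_ hl] IHl.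
have suffix k : (forall l, 0 < l <= n -> w (k + l) = w (i + l)) ->
    wcount w (k + (n.+1 - l.+1)) l.+2 =
    w (k + (n.+1 - l.+1)) + (wcount w i.+1 l + w (k + n.+1)).
  move=> Ek; rewrite wcountSl wcountSr; congr (_ + (_ + w _)); last lia.
  rewrite wcount_rev; apply: eq_bigr => t _; congr nat_of_bool.
  have tl := ltn_ord t.
  have -> : (k + (n.+1 - l.+1)).+1 + (l - t.+1) = k + (n.+1 - t.+1) by lia.
  rewrite Ek; last lia.
  by rewrite IHl ?addSnnS //; lia.
have prefix k : (forall l, 0 < l <= n -> w (k + l) = w (i + l)) ->
    wcount w k l.+2 = w k + (wcount w i.+1 l + w (i + l.+1)).
  move=> Ek; rewrite wcountSl wcountSr addSnnS Ek ?hl //; congr (_ + (_ + _)).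
  by apply: eq_bigr => t _; have tl := ltn_ord t; rewrite !addSnnS Ek //; lia.
have A := IH l.+2 ltac:(lia) (j + (n.+1 - l.+1)) i.
have B := IH l.+2 ltac:(lia) j (i + (n.+1 - l.+1)).
rewrite suffix // prefix // w_i w_jn M in A; last lia.
rewrite suffix // prefix // w_j w_in in B.
by move: A B; case: (w _); case: (w _); lia.
Qed.

Lemma sturmian_balanced : sturmian w ->
  forall n i j, wcount w i n <= (wcount w j n).+1.
Proof.
move=> st; elim/ltn_ind => N IH i j; rewrite leqNgt; apply/negP => H.
have {IH} [n [_ [w_j w_i w_jn w_in] M P]] := min_unbalanced N j i IH ltac:(lia).
have uniq k a b c d : same_factor k a b -> w (a + k) != w (b + k) ->
    same_factor k c d -> w (c + k) != w (d + k) -> same_factor k a c.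
  (* Length zero is split off because [sturmian] speaks of positive lengths only; there agreement is
     vacuous. *)
  case: k => [|k]; first by move=> _ _ _ _ l.
  by apply: right_special_uniq; rewrite !st.
have [a [b [Eab Dab]]] := right_special_ex n.+1 ltac:(by rewrite !st).
(* The palindrome u is right special, being followed by 0 after [j] and by 1 after [i]. Suffixes of
   right special words are right special, so by uniqueness the word at [a] is cu with c = [w a]. *)
have Ea : same_factor n a.+1 j.+1.
  apply: (uniq n a.+1 b.+1 j.+1 i.+1); rewrite ?addSnnS ?w_jn ?w_in //.
    by move=> l ln; rewrite !addSnnS Eab.
  by move=> l ln; rewrite !addSnnS M //; lia.
(* Start at whichever of 0u0 and 1u1 begins with the letter other than [w a]. *)
pose p := if w a then j else i.
have [w_p w_pn Ep] : [/\ w p = ~~ w a, w (p + n.+1) = ~~ w a &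
    forall l, 0 < l <= n -> w (p + l) = w (j + l)].
  by rewrite /p; case: ifP => _; split => //.
(* An occurrence at [p + e] begins with [w a], so [e] is neither 0 nor [n.+1]. Otherwise it places
   the letter of u mirrored to position [e], hence [w a], at position [p + n.+1], which carries the
   other letter. *)
have not_a q : p <= q <= p + n.+1 -> ~ same_factor n.+1 q a.
  move=> hq Eq; have w_q := Eq 0 isT; rewrite !addn0 in w_q.
  have [e qe] : exists e, q = p + e by exists (q - p); lia.
  subst q; have e0 : e != 0 by apply/eqP => e0; move: w_q; rewrite e0 addn0 w_p; case: (w a).
  have en : e != n.+1 by apply/eqP => en; move: w_q; rewrite en w_pn; case: (w a).
  have h1 := Eq (n.+1 - e) ltac:(lia).
  have h2 := Ea (n - e) ltac:(lia).
  move: h1 h2.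
  have -> : p + e + (n.+1 - e) = p + n.+1 by lia.
  have -> : a + (n.+1 - e) = a.+1 + (n - e) by lia.
  have -> : j.+1 + (n - e) = j + (n.+1 - e) by lia.
  move=> <-; rewrite w_pn P; last lia.
  rewrite -Ep ?w_q; last lia.
  by case: (w a).
(* Pigeonhole: there are [n.+2] starting positions but only [n.+1] factors of length [n.+1] besides
   the right special one. *)
have [x [y [/andP[px xy] yn Exy]]] :
    exists x y, [/\ p <= x < y, y <= p + n.+1 & same_factor n.+1 x y].
  have : ~~ injectiveb (fun l : 'I_n.+2 => factor w (p + l) n.+1).
    apply/negP => /injectiveP inj.
    have : (fun l : 'I_n.+2 => factor w (p + l) n.+1) @: setT
        \subset factors n.+1 :\ factor w a n.+1.
      apply/subsetP => _ /imsetP[l _ ->]; rewrite in_setD1 mem_factors andbT.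
      by apply/eqP => /factor_eqP /not_a; apply; have := ltn_ord l; lia.
    move=> /subset_leq_card; rewrite card_imset // cardsT card_ord.
    have := cardsD1 (factor w a n.+1) (factors n.+1).
    have : Comp w n.+1 = n.+2 by exact: st.
    by rewrite mem_factors /Comp -/(factors _); lia.
  move=> /injectivePn[k [l ne]] /factor_eqP E.
  have kn := ltn_ord k; have ln := ltn_ord l.
  have ne' : val k <> val l by move=> e; move/eqP: ne; apply; exact: val_inj.
  case: (ltngtP k l) => [h|h|//].
    by exists (p + k), (p + l); split => //; lia.
  by exists (p + l), (p + k); split; [lia|lia|exact: same_factor_sym].
(* Only the right special word leaves a choice for the next letter; elsewhere equal windows stay
   equal after one step. *)
have next u v : same_factor n.+1 u v -> ~ same_factor n.+1 u a ->
    same_factor n.+1 u.+1 v.+1.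
  move=> Euv Nu; apply: same_factor_shift => //; apply/eqP/negPn/negP => D.
  exact/Nu/(uniq n.+1 u v a b).
have cyc t : exists r, x <= r < y /\ same_factor n.+1 (x + t) r.
  elim: t => [|t [r [hr Er]]]; first by exists x; rewrite addn0; split => //; lia.
  have Er' : same_factor n.+1 (x + t.+1) r.+1.
    rewrite addnS; apply: next => // Ext.
    by apply: (not_a r); [lia | exact: same_factor_trans (same_factor_sym _ _ _ Er) Ext].
  case: (ltngtP r.+1 y) => [h|h|e]; [by exists r.+1; split => //; lia|lia|].
  exists x; split; first lia.
  by rewrite e in Er'; apply: same_factor_trans Er' (same_factor_sym _ _ _ Exy).
have never u : x <= u -> ~ same_factor n.+1 u a.
  move=> xu Eu; have [r [hr Er]] := cyc (u - x).
  apply: (not_a r); first lia.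
  by rewrite subnKC // in Er; apply: same_factor_trans (same_factor_sym _ _ _ Er) Eu.
(* From [x] on the continuation is forced, so every tail is one of the [y] tails starting before
   [y]. This leaves at most [y] factors of length [y], against [y.+1]. *)
have fin u : exists2 r, r < y & forall t, w (u + t) = w (r + t).
  case: (ltnP u x) => xu; first by exists u => //; lia.
  have [r [hr Er]] := cyc (u - x); exists r; first lia.
  rewrite subnKC // in Er.
  suff E t : same_factor n.+1 (u + t) (r + t) by move=> t; have := E t 0 isT; rewrite !addn0.
  by elim: t => [|t IH]; rewrite ?addn0 // !addnS; apply: next => //; apply: never; lia.
have : factors y \subset (fun r : 'I_y => factor w r y) @: setT.
  apply/subsetP => _ /factorsP[u ->]; have [r ry E] := fin u.
  apply/imsetP; exists (Ordinal ry) => //=.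
  by apply/factor_eqP => l _.
move/subset_leq_card/leq_trans => /(_ _ (leq_imset_card _ _)).
rewrite cardsT card_ord => hy; have := st y ltac:(lia).
by rewrite /Comp -/(factors _); lia.
Qed.

Lemma periodic_count T : 0 < T -> (forall i, w (i + T) = w i) ->
  forall n i j, wcount w i n <= wcount w j n + T.
Proof.
move=> T0 per.
have full i : wcount w i T = wcount w 0 T.
  elim: i => // i <-; apply/eqP; rewrite -(eqn_add2l (w i)) -wcountSl wcountSr per.
  by rewrite addnC.
have mul q i : wcount w i (q * T) = q * wcount w 0 T.
  by elim: q i => [|q IH] i; rewrite ?wcount0 // !mulSn wcountD full IH.
move=> n i j; rewrite (divn_eq n T) !wcountD !mul -addnA leq_add2l.
by have := wcount_leq (i + n %/ T * T) (n %% T); have := ltn_pmod n T0; lia.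
Qed.

Lemma periodic_Comp T : 0 < T -> (forall i, w (i + T) = w i) ->
  forall n, Comp w n <= T.
Proof.
move=> T0 per n.
have perq q i : w (i + q * T) = w i by elim: q => [|q IH]; rewrite ?addn0 // mulSnr addnA per.
rewrite -[leqRHS](card_ord T) -cardsT.
apply: leq_trans (leq_imset_card (fun r : 'I_T => factor w r n) _).
apply/subset_leq_card/subsetP => _ /factorsP[u ->].
apply/imsetP; exists (Ordinal (ltn_pmod u T0)) => //=; apply/factor_eqP => l _.
have -> : u + l = u %% T + l + u %/ T * T by have := divn_eq u T; lia.
by rewrite perq.
Qed.

Lemma Comp0 : Comp w 0 <= 1.
Proof.
rewrite /Comp -/(factors 0); apply: leq_trans (max_card _) _.
by rewrite card_tuple expn0.
Qed.

(** Besides the slope, these two properties are all that the rest of the proof takes from the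
    word. *)
Lemma low_complexity_word : periodic w \/ sturmian w ->
  exists C, (forall n i j, wcount w i n <= wcount w j n + C) /\
            (forall n, Comp w n <= C * n.+1).
Proof.
case=> [[T [T0 per]]|st].
  exists T; split; first exact: periodic_count.
  by move=> n; apply: leq_trans (periodic_Comp T T0 per n) _; rewrite leq_pmulr.
exists 1; split => [n i j|[|n]]; rewrite ?addn1 ?mul1n ?Comp0 //.
  exact: sturmian_balanced.
by rewrite st.
Qed.

End WordCount.

(** * The word of block ends *)

Section Blocks.
Local Open Scope nat_scope.
Variable K : nat -> nat.
Hypothesis K_gt0 : forall i, 0 < K i.

Lemma bstart0 : bstart K 0 = 0.
Proof. by rewrite /bstart big_ord0. Qed.

Lemma bstartS i : bstart K i.+1 = bstart K i + K i.
Proof. by rewrite /bstart big_ord_recr. Qed.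

Lemma leq_bstart i j : i <= j -> bstart K i <= bstart K j.
Proof.
move=> /subnKC <-; elim: (j - i) => [|k IH]; rewrite ?addn0 // addnS bstartS.
exact: leq_trans IH (leq_addr _ _).
Qed.

Lemma ltn_bstart i j : i < j -> bstart K i < bstart K j.
Proof.
move=> h; apply: leq_trans (leq_bstart _ _ h); rewrite bstartS.
by have := K_gt0 i; lia.
Qed.

Lemma bstart_geq i : i <= bstart K i.
Proof. by elim: i => // i IH; apply: leq_ltn_trans IH (ltn_bstart _ _ _). Qed.

(** The maximum in [block_of] runs over indices up to [p] only; nothing is lost, since nonempty
    blocks give [i <= bstart K i]. *)
Lemma block_of_bounds p : bstart K (block_of K p) <= p < bstart K (block_of K p).+1.
Proof.
have le_p i : bstart K i <= p -> i <= block_of K p.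
  move=> h; have ip : i < p.+1 by apply: leq_ltn_trans (bstart_geq i) _; rewrite ltnS.
  exact: (bigmax_sup (Ordinal ip)).
have h0 : bstart K 0 <= p by rewrite bstart0.
apply/andP; split; last by rewrite ltnNge; apply/negP => /le_p; rewrite ltnn.
rewrite /block_of; elim/big_ind: _ => // x y hx hy.
by rewrite /maxn; case: ifP.
Qed.

Lemma block_of_uniq i p : bstart K i <= p < bstart K i.+1 -> block_of K p = i.
Proof.
have /andP[h1 h2] := block_of_bounds p.
case: (ltngtP (block_of K p) i) => // h; have := leq_bstart _ _ h; lia.
Qed.

Lemma block_of0 : block_of K 0 = 0.
Proof. by apply: block_of_uniq; rewrite bstart0 bstartS bstart0 add0n leqnn K_gt0. Qed.

Lemma block_ofS p : block_of K p.+1 = block_of K p + is_last K p.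
Proof.
have /andP[h1 h2] := block_of_bounds p; apply: block_of_uniq.
rewrite /is_last; case: eqP => h; rewrite ?addn1 ?addn0.
  by rewrite h leqnn ltn_bstart.
by rewrite ltn_neqAle h2 leqW // andbT; apply/eqP.
Qed.

Lemma wcount_is_last p n : block_of K p + wcount (is_last K) p n = block_of K (p + n).
Proof.
elim: n => [|n IH]; first by rewrite wcount0 !addn0.
by rewrite wcountSr addnA IH addnS block_ofS.
Qed.

Lemma is_lastP p : reflect (exists i, p.+1 = bstart K i.+1) (is_last K p).
Proof.
apply: (iffP eqP) => [->|[i E]]; first by exists (block_of K p).
rewrite E; congr (bstart K _.+1); apply/esym/block_of_uniq; rewrite -E leqnn.
by rewrite andbT; have := ltn_bstart i i.+1 (leqnn _); rewrite -E ltnS.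
Qed.

End Blocks.

(** * Transfer of balance and complexity from [w] to the word of block ends *)

Section CodedWord.
Local Open Scope nat_scope.
Variables (m : nat) (w : nat -> bool).
Hypothesis m_ge2 : 2 <= m.

Let K := Kmw m w.

Lemma KmwE i : K i = m + w i.
Proof. by []. Qed.

Lemma Kmw_gt0 i : 0 < K i.
Proof. by rewrite KmwE; lia. Qed.

Lemma bstart_Kmw i t : bstart K (i + t) = bstart K i + m * t + wcount w i t.
Proof.
elim: t => [|t IH]; first by rewrite wcount0 muln0 !addn0.
rewrite addnS bstartS IH wcountSr KmwE mulnS; lia.
Qed.

(** Compare lengths: up to one block, a window with t block ends contains t blocks, while one with s
    block ends fits into s+1 blocks. If t exceeded s by more than [C + m.+1], the extra blocks, of
    length at least [m], would outweigh the discrepancy [C] and the incomplete block. *)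
Lemma is_last_balanced C : (forall n i j, wcount w i n <= wcount w j n + C) ->
  forall n p q, wcount (is_last K) p n <= wcount (is_last K) q n + (C + m.+1).
Proof.
move=> bal n p q; rewrite leqNgt; apply/negP => h.
have [/andP[p1 p2] /andP[q1 q2]] := (block_of_bounds K Kmw_gt0 p, block_of_bounds K Kmw_gt0 q).
have := block_of_bounds K Kmw_gt0 (p + n); have := block_of_bounds K Kmw_gt0 (q + n).
rewrite -!wcount_is_last; try exact: Kmw_gt0.
move: h p1 p2 q1 q2; set i := block_of K p; set j := block_of K q.
set t := wcount _ p n; set s := wcount _ q n => h p1 p2 q1 q2.
rewrite -(addnS j s) !bstart_Kmw => /andP[_ b1] /andP[b2 _].
have wi : w i <= 1 by case: (w i).
rewrite bstartS KmwE in p2.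
have := bal s.+1 j i.
have : wcount w i s.+1 <= wcount w i t by apply: leq_wcount; lia.
have : m * (s.+1 + (C + m)) <= m * t by rewrite leq_mul2l; apply/orP; right; lia.
have : 2 * (C + m) <= m * (C + m) by rewrite leq_mul2r m_ge2 orbT.
rewrite (mulnDr m s.+1); lia.
Qed.

(** The offset of the start inside its block and the lengths of the blocks from there on determine
    the window; at most [n] of these blocks can end in it. *)
Lemma same_factor_is_last p q n :
  p - bstart K (block_of K p) = q - bstart K (block_of K q) ->
  same_factor w n (block_of K p) (block_of K q) -> same_factor (is_last K) n p q.
Proof.
have imp x y : x - bstart K (block_of K x) = y - bstart K (block_of K y) ->
  same_factor w n (block_of K x) (block_of K y) ->
  forall l, l < n -> is_last K (x + l) -> is_last K (y + l).
  move=> E S l ln /(is_lastP K Kmw_gt0)[i Ei]; apply/(is_lastP K Kmw_gt0).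
  have [/andP[x1 x2] /andP[y1 y2]] := (block_of_bounds K Kmw_gt0 x, block_of_bounds K Kmw_gt0 y).
  move: E S x1 x2 y1 y2; set bx := block_of K x; set by_ := block_of K y => E S x1 x2 y1 y2.
  have bi : bx <= i.
    rewrite leqNgt; apply/negP => h; have := leq_bstart K _ _ h; lia.
  exists (by_ + (i - bx)); move: Ei.
  have -> : i.+1 = bx + (i - bx).+1 by lia.
  rewrite -(addnS by_) !bstart_Kmw; move: (i - bx) => t Ei.
  have tn : t < n.
    have wt : wcount w bx t.+1 = w bx + wcount w bx.+1 t by rewrite wcountSl.
    rewrite bstartS KmwE in x2.
    have : 2 * t <= m * t by rewrite leq_mul2r m_ge2 orbT.
    by rewrite mulnS in Ei; lia.
  have -> : wcount w by_ t.+1 = wcount w bx t.+1.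
    by apply: eq_bigr => k _; rewrite S // (leq_trans (ltn_ord k)).
  lia.
move=> E S l ln; apply/idP/idP; apply: imp => //.
exact: same_factor_sym.
Qed.

(** A factor is encoded by a chosen occurrence: its offset in the block, with at most [m.+1] values,
    and the factor of [w] from that block on. *)
Lemma Comp_is_last n : Comp (is_last K) n <= m.+1 * Comp w n.
Proof.
have ex_pos (t : n.-tuple bool) :
    exists p, t \in factors (is_last K) n -> t = factor (is_last K) p n.
  case: (boolP (t \in _)) => [/factorsP[p ->]|_]; [by exists p | by exists 0].
pose pos t := proj1_sig (ClassicalEpsilon.constructive_indefinite_description _ (ex_pos t)).
have posE t : t \in factors (is_last K) n -> t = factor (is_last K) (pos t) n.
  exact: proj2_sig (ClassicalEpsilon.constructive_indefinite_description _ (ex_pos t)).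
pose code t : 'I_m.+1 * n.-tuple bool :=
  (inord (pos t - bstart K (block_of K (pos t))), factor w (block_of K (pos t)) n).
have inj : {in factors (is_last K) n &, injective code}.
  move=> s t hs ht E; have Eo := congr1 (fun c => val c.1) E.
  have Ef : factor w _ n = factor w _ n := congr1 snd E.
  rewrite (posE s hs) (posE t ht); apply/factor_eqP/same_factor_is_last; last exact/factor_eqP.
  have off x : x - bstart K (block_of K x) < m.+1.
    have /andP[x1 x2] := block_of_bounds K Kmw_gt0 x.
    by rewrite bstartS KmwE in x2; case: (w _) x2; lia.
  by move: Eo; rewrite /= !inordK.
rewrite {1}/Comp -/(factors _ _) -(card_in_imset inj) -[X in X * _](card_ord m.+1) -cardsT -cardsX.
apply/subset_leq_card/subsetP => _ /imsetP[t ht ->].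
by rewrite in_setX in_setT mem_factors.
Qed.

End CodedWord.

(** * Multilinear evaluations *)

Section DimSub.
Local Open Scope nat_scope.
Variables (F : fieldType) (N : nat) (I : 'rV[F]_N -> Prop).

Lemma codim_leq D (W : 'M[F]_(N, D)) :
  (forall v, v *m W = 0 -> I v)%R -> N - dim_sub I <= D.
Proof.
move=> WI; have : \rank (kermx W) <= dim_sub I.
  have rN : \rank (kermx W) < N.+1 by rewrite ltnS rank_leq_row.
  apply: (bigmax_sup (Ordinal rN)) => //=; apply/classicbP; exists (kermx W).
  by split => // v /sub_kermxP; apply: WI.
by rewrite mxrank_ker; have := rank_leq_col W; lia.
Qed.

(** The columns of [V] are functionals vanishing on [I], and the dual system [M] shows that they are
    independent. *)
Lemma codim_geq r (V : 'M[F]_(N, r)) (M : 'M[F]_(r, N)) :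
  (forall v, I v -> v *m V = 0)%R -> (M *m V = 1%:M)%R -> r <= N - dim_sub I.
Proof.
move=> IV MV.
have rV : r <= \rank V by rewrite -[leqLHS](mxrank1 F) -MV mxrankM_maxr.
have : dim_sub I <= N - \rank V.
  apply/bigmax_leqP => i /classicbP[U [<- UI]].
  rewrite -mxrank_ker; apply/mxrankS/row_subP => l; apply/sub_kermxP/IV/UI.
  exact: row_sub.
by have := rank_leq_row V; lia.
Qed.

End DimSub.

(** * Monomials as trees and left-normed monomials *)

Section Trees.
Local Open Scope nat_scope.

Lemma ntree_comparable : eqtype.comparable ntree.
Proof. by rewrite /eqtype.comparable /decidable; do 2!decide equality. Qed.

HB.instance Definition _ := hasDecEq.Build ntree (compareP ntree_comparable).

Fixpoint leaves (t : ntree) : seq nat :=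
  match t with Leaf i => [:: i] | Node l r => leaves l ++ leaves r end.

(** Head and successive right factors of a left-normed monomial; [None] means that some right factor
    is itself a product. *)
Fixpoint spine (t : ntree) : option (nat * seq nat) :=
  match t with
  | Leaf i => Some (i, [::])
  | Node l (Leaf j) => if spine l is Some (h, s) then Some (h, rcons s j) else None
  | Node _ (Node _ _) => None
  end.

Definition left_comb (h : nat) (s : seq nat) : ntree :=
  foldl (fun t j => Node t (Leaf j)) (Leaf h) s.

Lemma spine_left_comb h s : spine (left_comb h s) = Some (h, s).
Proof.
by elim/last_ind: s => // s j IH; rewrite /left_comb foldl_rcons /= -/(left_comb h s) IH.
Qed.

Lemma spine_leaves t h s : spine t = Some (h, s) -> leaves t = h :: s.
Proof.
elim: t h s => [i|l IHl [j|? ?] _] h s //=; first by case=> -> <-.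
case E: (spine l) => [[h' s']|] // [<- <-]; rewrite (IHl _ _ E) /=.
by rewrite cats1.
Qed.

Lemma brackets_leaves fuel s t : t \in brackets fuel s -> leaves t = s.
Proof.
elim: fuel s t => // fuel IH [|x [|y s]] t; [by [] | by rewrite inE => /eqP -> |].
case/flatten_mapP => k _ /allpairsP[[l r] /= [/IH El /IH Er ->]] /=.
by rewrite El Er cat_take_drop.
Qed.

Lemma left_comb_brackets fuel h s : size s < fuel -> left_comb h s \in brackets fuel (h :: s).
Proof.
elim: fuel s => // fuel IH s; case/lastP: s => [_|s x]; first exact: mem_head.
rewrite size_rcons ltnS => hs.
have -> : brackets fuel.+1 (h :: rcons s x) =
    flatten [seq [seq Node l r | l <- brackets fuel (take k (h :: rcons s x)),
                                 r <- brackets fuel (drop k (h :: rcons s x))]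
            | k <- iota 1 (size (h :: rcons s x)).-1] by case: (s).
apply/flatten_mapP; exists (size s).+1.
  by rewrite mem_iota /= size_rcons; lia.
rewrite /= -cats1 take_size_cat // drop_size_cat // cats1.
apply/allpairsP; exists (left_comb h s, Leaf x); split => /=.
- exact: IH.
- by case: fuel hs {IH} => // fuel _; rewrite mem_head.
- by rewrite /left_comb foldl_rcons.
Qed.

Lemma monomials_leaves n t : t \in monomials n -> perm_eq (leaves t) (iota 0 n).
Proof.
by case/flatten_mapP => p; rewrite mem_permutations => hp /brackets_leaves ->.
Qed.

Lemma left_comb_monomials n h s : perm_eq (h :: s) (iota 0 n) -> left_comb h s \in monomials n.
Proof.
move=> hp; apply/flatten_mapP; exists (h :: s); first by rewrite mem_permutations.
exact: left_comb_brackets.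
Qed.

(** Serves to build a left-normed monomial whose variables at the b-positions of [u] form a
    prescribed set. *)
Lemma interleave (P : pred nat) (u : seq bool) (A B : seq nat) :
  all P A -> all (predC P) B -> size A = count id u -> size B = count negb u ->
  exists2 s, perm_eq s (A ++ B) & map P s = u.
Proof.
elim: u A B => [|b u IH] A B; first by case: A; case: B => //; exists [::].
case: b => /= PA PB.
  case: A PA => // a A /andP[Pa PA] [sA] sB; have [s sp sE] := IH A B PA PB sA sB.
  by exists (a :: s); rewrite /= ?Pa ?sE // perm_cons.
case: B PB => // b B /andP[/negbTE Pb PB] sA [sB]; have [s sp sE] := IH A B PA PB sA sB.
exists (b :: s); last by rewrite /= Pb sE.
by rewrite perm_sym (perm_catCA A [:: b] B) /= perm_cons perm_sym.
Qed.

End Trees.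

(** * Values of monomials in the algebra *)

Section Evaluation.
Import GRing.Theory.
Local Open Scope ring_scope.
Variables (F : fieldType) (K : nat -> nat).
Implicit Types (sigma : nat -> Aelt F) (t : ntree).

Lemma coef_eval_Node sigma l r q : (zpart (eval_mon K sigma (Node l r)))`_q =
  if q is p.+1 then (zpart (eval_mon K sigma l))`_p *
    (if is_last K p then bcoef (eval_mon K sigma r) else acoef (eval_mon K sigma r))
  else 0.
Proof.
rewrite coefXM; case: q => //= p; rewrite coef_poly; case: ltnP => // h.
by rewrite nth_default // mul0r.
Qed.

(** A product has neither an a- nor a b-component, so right multiplication by it gives zero. *)
Lemma eval_no_spine sigma t : spine t = None -> zpart (eval_mon K sigma t) = 0.
Proof.
elim: t => // l IHl r _ E; apply/polyP => q; rewrite coef_eval_Node coef0.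
case: q => // p; case: r E => [j|l' r'] /=; last by rewrite if_same mulr0.
by case E': (spine l) => [[]|] // _; rewrite IHl // coef0 mul0r.
Qed.

(** Each right factor moves the position by one, and the letter of the word of block ends there
    decides whether it acts through its b- or its a-component. *)
Lemma eval_spine sigma t h s q : spine t = Some (h, s) ->
  (zpart (eval_mon K sigma t))`_q =
  if (q < size s)%N then 0 else (zpart (sigma h))`_(q - size s) *
    \prod_(l < size s) (if is_last K (q - size s + l) then bcoef (sigma (nth 0%N s l))
                        else acoef (sigma (nth 0%N s l))).
Proof.
elim: t h s q => [i|l IHl [j|? ?] _] h s q; last by [].
  by case=> -> <-; rewrite big_ord0 mulr1 subn0.
rewrite coef_eval_Node /=.
case E: (spine l) => [[h' s']|] // [<- <-]; rewrite size_rcons.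
case: q => // q; rewrite (IHl _ _ _ E) ltnS; case: ltnP => hq; first by rewrite mul0r.
rewrite subSS -mulrA big_ord_recr /=; congr (_ * (_ * _)).
  by apply: eq_bigr => k _; rewrite nth_rcons ltn_ord.
by rewrite subnK // nth_rcons ltnn eqxx.
Qed.

Lemma zpart_eval_poly n (f : 'rV[F]_(Nmon n)) sigma :
  zpart (eval_poly K f sigma) =
  \sum_(t < Nmon n) f 0 t *: zpart (eval_mon K sigma (nth (Leaf 0) (monomials n) t)).
Proof. by rewrite /eval_poly; elim/big_ind2: _ => // x a y b <- <-. Qed.

Lemma mem_nth_monomials n (t : 'I_(Nmon n)) : nth (Leaf 0) (monomials n) t \in monomials n.
Proof. exact/mem_nth/ltn_ord. Qed.

Lemma eval_poly_eq0 n (f : 'rV[F]_(Nmon n)) sigma : (1 < n)%N ->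
  zpart (eval_poly K f sigma) = 0 -> eval_poly K f sigma = A0 F.
Proof.
move=> n1 z0.
suff : acoef (eval_poly K f sigma) = 0 /\ bcoef (eval_poly K f sigma) = 0.
  by move: z0; case: (eval_poly _ _ _) => a b z /= -> [-> ->].
rewrite /eval_poly; elim/big_ind: _ => // [x y [xa xb] [ya yb]|t _] /=.
  by rewrite xa xb ya yb addr0.
have := perm_size (monomials_leaves n _ (mem_nth_monomials n t)).
by case: (nth _ _ _) => [i|l r] /=; rewrite ?mulr0 // size_iota => e; rewrite -e in n1.
Qed.

End Evaluation.

(** * Coefficient sums that detect identities *)

Section Functionals.
Import GRing.Theory.
Local Open Scope ring_scope.
Variables (F : fieldType) (K : nat -> nat) (N : nat).
Hypothesis N_gt0 : (0 < N)%N.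
Local Notation n := N.+1.
Local Notation mon := (nth (Leaf 0) (monomials n)).

Definition args_at (u : N.-tuple bool) (s : seq nat) : {set 'I_n} :=
  [set x : 'I_n | (val x \in s) && nth false u (index (val x) s)].

Definition pattern_coef (u : N.-tuple bool) (h : 'I_n) (T : {set 'I_n}) (t : ntree) : F :=
  if spine t is Some (h', s) then ((h' == h :> nat) && (T == args_at u s))%:R else 0.

Definition weight (sigma : nat -> Aelt F) (h : 'I_n) (T : {set 'I_n}) : F :=
  \prod_(x : 'I_n | x != h) (if x \in T then bcoef (sigma x) else acoef (sigma x)).

Definition functional (f : 'rV[F]_(Nmon n)) u h T : F :=
  \sum_(t < Nmon n) f 0 t * pattern_coef u h T (mon t).

Lemma spine_monomials t h s : t \in monomials n -> spine t = Some (h, s) ->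
  perm_eq (h :: s) (iota 0 n).
Proof. by move=> /monomials_leaves + E; rewrite (spine_leaves _ _ _ E). Qed.

(** Stated for any commutative monoid, since it serves both the product of coefficients and the
    count of b-positions. *)
Lemma big_args (T : Type) (idx : T) (op : Monoid.com_law idx) (f g : nat -> T)
    (u : N.-tuple bool) (h : 'I_n) s :
  perm_eq (val h :: s) (iota 0 n) ->
  \big[op/idx]_(l < N) (if nth false u l then f (nth 0%N s l) else g (nth 0%N s l)) =
  \big[op/idx]_(x : 'I_n | x != h) (if x \in args_at u s then f x else g x).
Proof.
move=> hp; have sN : size s = N by have := perm_size hp; rewrite /= size_iota => -[].
have /andP[hs us] : uniq (val h :: s) by rewrite (perm_uniq hp) iota_uniq.
pose e x := if nth false u (index x s) then f x else g x.
transitivity (\big[op/idx]_(x <- s) e x).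
  rewrite (big_nth 0%N) big_mkord sN; apply: eq_bigr => l _.
  by rewrite /e index_uniq ?sN.
transitivity (\big[op/idx]_(x <- val h :: s | x != h) e x).
  rewrite big_cons eqxx /= [RHS]big_seq_cond [LHS]big_seq; apply: eq_bigl => x.
  by case: (boolP (x \in s)) => // xs; apply/esym; apply: contraNneq hs => e1; rewrite /= -e1.
have iotaE : iota 0 n = index_iota 0 n by rewrite /index_iota subn0.
rewrite (perm_big _ hp) iotaE big_mkord.
apply: eq_bigr => x xh; rewrite /e inE.
suff -> : val x \in s by [].
have : val x \in val h :: s by rewrite (perm_mem hp) mem_iota /= add0n ltn_ord.
by rewrite inE => /orP[/eqP/val_inj e'|//]; rewrite e' eqxx in xh.
Qed.

Lemma card_args_at (u : N.-tuple bool) (h : 'I_n) s :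
  perm_eq (val h :: s) (iota 0 n) ->
  h \notin args_at u s /\ #|args_at u s| = count id u.
Proof.
move=> hp; have /andP[hs _] : uniq (val h :: s) by rewrite (perm_uniq hp) iota_uniq.
have hN : h \notin args_at u s by rewrite inE negb_and hs.
split=> //; rewrite -sum1_card big_mkcond /= (bigD1 h) //= (negbTE hN) add0n.
rewrite -(big_args _ _ addn (fun=> 1%N) (fun=> 0%N) u h s hp).
rewrite -sum1_count [RHS]big_mkcond [RHS]big_tuple.
by apply: eq_bigr => l _; rewrite (tnth_nth false).
Qed.

Lemma pattern_coef_eq0 (u : N.-tuple bool) h (T : {set 'I_n}) t : t \in monomials n ->
  ~~ ((h \notin T) && (#|T| == count id u)) -> pattern_coef u h T t = 0.
Proof.
rewrite /pattern_coef; case E: (spine t) => [[h' s]|] // /spine_monomials /(_ E) hp.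
have [e|//] := h' =P val h; have [->|//] := T =P args_at u s.
by rewrite e in hp; have [-> ->] := card_args_at u _ _ hp; rewrite eqxx.
Qed.

Lemma coef_eval_mon sigma t q : t \in monomials n ->
  (zpart (eval_mon K sigma t))`_q =
  if (q < N)%N then 0 else
  \sum_(h : 'I_n) \sum_(T : {set 'I_n}) (zpart (sigma h))`_(q - N) * weight sigma h T *
     pattern_coef (factor (is_last K) (q - N) N) h T t.
Proof.
move=> tm; rewrite /pattern_coef; case E: (spine t) => [[h s]|]; last first.
  rewrite eval_no_spine // coef0; case: ifP => // _.
  by rewrite big1 // => h _; rewrite big1 // => T _; rewrite mulr0.
have hp := spine_monomials _ _ _ tm E.
have sN : size s = N by have := perm_size hp; rewrite /= size_iota => -[].
rewrite (eval_spine _ _ _ _ _ _ _ E) sN; case: ifP => // _.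
have hn : (h < n)%N by have := perm_mem hp h; rewrite mem_head mem_iota => /esym/andP[].
pose u := factor (is_last K) (q - N) N.
rewrite (bigD1 (Ordinal hn)) //= (bigD1 (args_at u s)) //= !eqxx mulr1.
rewrite [X in _ = _ + X + _]big1 ?addr0; last first.
  by move=> T /negbTE ->; rewrite mulr0.
rewrite [X in _ = _ + X]big1 ?addr0; last first.
  move=> h' ne; rewrite big1 // => T _; rewrite (_ : (h == h' :> nat) = false) ?mulr0 //.
  by apply/negbTE; apply: contra ne => /eqP e; apply/eqP/val_inj.
congr (_ * _); rewrite /weight.
rewrite -(big_args _ _ _ (fun x => bcoef (sigma x)) (fun x => acoef (sigma x)) u (Ordinal hn) s hp).
by apply: eq_bigr => l _; rewrite (nth_map l) ?size_enum_ord // nth_ord_enum.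
Qed.

(** The z-part of a value depends on [f] only through the functionals; both codimension bounds rest
    on this. *)
Lemma coef_eval_poly sigma (f : 'rV[F]_(Nmon n)) q :
  (zpart (eval_poly K f sigma))`_q =
  if (q < N)%N then 0 else
  \sum_(h : 'I_n) \sum_(T : {set 'I_n}) (zpart (sigma h))`_(q - N) * weight sigma h T *
     functional f (factor (is_last K) (q - N) N) h T.
Proof.
rewrite zpart_eval_poly coef_sum.
under eq_bigr => t _ do rewrite coefZ coef_eval_mon ?mem_nth_monomials //.
case: ifP => _; first by rewrite big1 // => t _; rewrite mulr0.
under eq_bigr => t _ do rewrite mulr_sumr.
rewrite exchange_big; apply: eq_bigr => h _ /=.
under eq_bigr => t _ do rewrite mulr_sumr.
rewrite exchange_big; apply: eq_bigr => T _ /=.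
by rewrite mulr_sumr; apply: eq_bigr => t _; rewrite mulrCA.
Qed.

(** [adm] stands for all substitutions or for the graded ones. [E] contains every pattern that such
    a substitution makes visible, so the vanishing of its functionals forces an identity. *)
Lemma codim_leq_patterns (I : 'rV[F]_(Nmon n) -> Prop) (adm : (nat -> Aelt F) -> Prop)
    (E : {set N.-tuple bool * 'I_n * {set 'I_n}}) :
  (forall f, (forall sigma, adm sigma -> eval_poly K f sigma = A0 F) -> I f) ->
  (forall sigma, adm sigma -> forall p h (T : {set 'I_n}),
     h \notin T -> #|T| = count id (factor (is_last K) p N) ->
     (zpart (sigma h))`_p != 0 -> weight sigma h T != 0 ->
     (factor (is_last K) p N, h, T) \in E) ->
  (Nmon n - dim_sub I <= #|E|)%N.
Proof.
move=> admI admE.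
pose M : 'M[F]_(Nmon n, #|E|) :=
  \matrix_(t, e) pattern_coef (enum_val e).1.1 (enum_val e).1.2 (enum_val e).2 (mon t).
apply: (codim_leq _ _ _ _ M) => f fM; apply: admI => sigma adm_s.
have fE u h T : (u, h, T) \in E -> functional f u h T = 0.
  move=> uE; have := congr1 (fun A : 'rV_ _ => A 0 (enum_rank_in uE (u, h, T))) fM.
  rewrite !mxE => e; rewrite -[RHS]e; apply: eq_bigr => t _.
  by rewrite mxE enum_rankK_in.
apply: eval_poly_eq0 => //; apply/polyP => q; rewrite coef_eval_poly coef0.
case: ifP => // _; rewrite big1 // => h _; rewrite big1 // => T _.
have [->|z0] := eqVneq (zpart (sigma h))`_(q - N) 0; first by rewrite !mul0r.
have [->|w0] := eqVneq (weight sigma h T) 0; first by rewrite mulr0 mul0r.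
have [/andP[hT /eqP cT]|hT] :=
    boolP ((h \notin T) && (#|T| == count id (factor (is_last K) (q - N) N))).
  by rewrite fE ?mulr0 //; exact: (admE _ adm_s _ _ _ hT cT z0 w0).
rewrite /functional big1 ?mulr0 // => t _.
by rewrite pattern_coef_eq0 ?mulr0 // mem_nth_monomials.
Qed.

(** Provides monomials dual to the functionals with head [ord0], whence these are independent. *)
Lemma pattern_monomial (u : N.-tuple bool) (T : {set 'I_n}) :
  ord0 \notin T -> #|T| = count id u ->
  exists2 t, t \in monomials n & forall T', pattern_coef u ord0 T' t = (T' == T)%:R.
Proof.
move=> T0 cT.
pose P := [pred x : nat | [exists y in T, val y == x]].
have PE (y : 'I_n) : P (val y) = (y \in T).
  apply/existsP/idP => [[x /andP[xT /eqP/val_inj <-//]]|yT].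
  by exists y; rewrite yT eqxx.
pose A := [seq val x | x <- enum T]; pose B := [seq val x | x <- enum (~: (ord0 |: T))].
have perm0 : perm_eq (0%N :: A ++ B) (iota 0 n).
  rewrite -map_cat -val_enum_ord -[0%N :: _]/(map val (ord0 :: enum T ++ enum (~: (ord0 |: T)))).
  apply/perm_map/uniq_perm; rewrite ?enum_uniq //=.
    rewrite cat_uniq !enum_uniq /= mem_cat !mem_enum !inE eqxx (negbTE T0) /= andbT.
    by apply/hasPn => x; rewrite !mem_enum !inE negb_or => /andP[].
  move=> x; rewrite inE mem_cat !mem_enum !inE.
  by case: (x == ord0) => //=; case: (x \in T).
have sA : size A = count id u by rewrite size_map -cardE.
have sB : size B = count negb u.
  have := perm_size perm0; rewrite /= size_iota size_cat sA => -[].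
  have : count negb u = count (predC id) u by apply: eq_count.
  by have := count_predC id u; rewrite size_tuple; lia.
have PA : all P A by apply/allP => _ /mapP[x + ->]; rewrite mem_enum PE.
have PB : all (predC P) B.
  apply/allP => _ /mapP[x + ->]; rewrite mem_enum !inE negb_or /= => /andP[_ xT].
  by move: (PE x); rewrite /P /= => ->.
have [s sp sE] := interleave P u A B PA PB sA sB.
have hp : perm_eq (0%N :: s) (iota 0 n).
  by apply: (perm_trans _ perm0); rewrite perm_cons.
exists (left_comb 0 s); first exact: left_comb_monomials.
move=> T'; rewrite /pattern_coef spine_left_comb eqxx /=; congr (_ == _)%:R.
apply/setP => x; rewrite inE -PE.
case: (boolP (val x \in s)) => xs.
  by rewrite andTb -sE (nth_map 0%N) ?index_mem // nth_index.
rewrite andFb PE; apply/esym/negbTE; apply: contra xs => xT.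
by rewrite (perm_mem sp) mem_cat map_f // mem_enum.
Qed.

(** Sending variables in [T] to b and the others to a, with the first z added to variable 0,
    isolates one functional, which therefore vanishes on [I]. *)
Lemma codim_geq_patterns (I : 'rV[F]_(Nmon n) -> Prop) (adm : (nat -> Aelt F) -> Prop)
    (E : {set {set 'I_n}}) :
  (forall f, I f -> forall sigma, adm sigma -> eval_poly K f sigma = A0 F) ->
  (forall T, T \in E -> ord0 \notin T /\ #|T| = count id (factor (is_last K) 0 N)) ->
  (forall T, T \in E -> adm (fun x => mkA (inord x \notin T)%:R (inord x \in T)%:R
                                          (x == 0%N)%:R%:P)) ->
  (#|E| <= Nmon n - dim_sub I)%N.
Proof.
move=> Iadm E0 Eadm; pose u := factor (is_last K) 0 N.
have mon_ex (j : 'I_#|E|) : {t : 'I_(Nmon n) |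
    forall T', pattern_coef u ord0 T' (mon t) = (T' == enum_val j)%:R}.
  have [T0 cT] := E0 _ (enum_valP j).
  apply: ClassicalEpsilon.constructive_indefinite_description.
  have [t tm tE] := pattern_monomial u (enum_val j) T0 cT.
  have ti : (index t (monomials n) < Nmon n)%N by rewrite /Nmon index_mem.
  by exists (Ordinal ti) => /=; rewrite nth_index.
pose V : 'M[F]_(Nmon n, #|E|) := \matrix_(t, j) pattern_coef u ord0 (enum_val j) (mon t).
apply: (codim_geq _ _ _ _ V (\matrix_(j, t) (t == sval (mon_ex j))%:R)); last first.
  apply/matrixP => j k; rewrite !mxE (bigD1 (sval (mon_ex j))) //= big1 ?addr0.
    by rewrite !mxE eqxx mul1r (svalP (mon_ex j)) (inj_eq enum_val_inj) eq_sym.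
  by move=> t /negbTE ne; rewrite !mxE ne mul0r.
move=> f If; apply/rowP => j; rewrite !mxE.
set T := enum_val j; have TE : T \in E := enum_valP j.
have [T0 cT] := E0 _ TE.
transitivity (functional f u ord0 T).
  by apply: eq_bigr => t _; rewrite mxE.
have := congr1 (fun a : Aelt F => (zpart a)`_N) (Iadm f If _ (Eadm T TE)).
(* [N] right factors carry position 0 to position [N], so this coefficient reads the prefix of the
   word; only variable 0 has a z-part. *)
rewrite coef_eval_poly ltnn subnn coef0 (bigD1 ord0) //= [X in _ + X]big1 ?addr0; last first.
  move=> h h0; rewrite big1 // => T' _; rewrite (_ : (h == 0%N :> nat) = false).
    by rewrite coef0 !mul0r.
  by apply/negbTE; apply: contra h0 => /eqP e; apply/eqP/val_inj.
rewrite (bigD1 T) //= [X in _ + X]big1 ?addr0 => [|T' neT]; last first.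
  have [T0'|T0'] := boolP (ord0 \in T').
    rewrite /functional big1 ?mulr0 // => t _.
    by rewrite pattern_coef_eq0 ?mulr0 ?mem_nth_monomials // T0'.
  (* Both sets avoid the head, so they differ at another variable, whose component required by [T']
     is zero. *)
  have [x xT] : exists x, (x \in T') != (x \in T).
    apply/existsP; rewrite -negb_forall; apply: contra neT => /forallP h.
    by apply/eqP/setP => x; apply/eqP.
  rewrite /weight (bigD1 x) /=; last first.
    by apply: contra xT => /eqP ->; rewrite (negbTE T0) (negbTE T0').
  rewrite !inord_val; move: xT; case: (x \in T'); case: (x \in T) => //= _.
    by rewrite mul0r mulr0 mul0r.
  by rewrite mul0r mulr0 mul0r.
rewrite coefC /= mul1r /weight big1 ?mul1r // => x _.
by rewrite inord_val; case: (x \in T).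
Qed.

End Functionals.

(** * Bounds for the codimensions *)

Section Binomials.
Local Open Scope nat_scope.

Lemma leq_bin_addr n i e : 'C(n, i + e) <= n ^ e * 'C(n, i).
Proof.
elim: e => [|e IH]; first by rewrite addn0 mul1n.
rewrite addnS expnS -mulnA; apply: leq_trans (leq_mul (leqnn n) IH).
have := mul_bin_left n (i + e); have : (n - (i + e)) * 'C(n, i + e) <= n * 'C(n, i + e).
  by rewrite leq_mul2r leq_subr orbT.
by move=> + E; rewrite -E mulSn; lia.
Qed.

Lemma leq_bin_subr n i e : i + e <= n -> 'C(n, i) <= n ^ e * 'C(n, i + e).
Proof.
elim: e => [|e IH] h; first by rewrite addn0 mul1n.
apply: leq_trans (IH _) _; first by lia.
rewrite expnSr -mulnA leq_mul2l; apply/orP; right.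
have := mul_bin_left n (i + e).
have : 1 * 'C(n, i + e) <= (n - (i + e)) * 'C(n, i + e) by rewrite leq_mul2r; apply/orP; right; lia.
have : (i + e).+1 * 'C(n, (i + e).+1) <= n * 'C(n, i + e.+1).
  by rewrite addnS leq_mul2r -addnS h orbT.
lia.
Qed.

(** Up to index [n], neighbouring binomial coefficients differ by a factor of at most [n]. *)
Lemma leq_bin_near n i j d : 0 < n -> i <= n -> i <= j + d -> j <= i + d ->
  'C(n, j) <= n ^ d * 'C(n, i).
Proof.
move=> n0 i_n ij ji.
case: (leqP i j) => h.
  have -> : j = i + (j - i) by lia.
  apply: leq_trans (leq_bin_addr _ _ _) _.
  by rewrite leq_mul2r leq_pexp2l ?orbT //; lia.
have e : i = j + (i - j) by lia.
apply: leq_trans (leq_bin_subr _ j (i - j) _) _; first by lia.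
by rewrite -e leq_mul2r leq_pexp2l ?orbT //; lia.
Qed.

End Binomials.

(** * Ordinary and graded codimensions against one binomial coefficient *)

Section Codimensions.
Import GRing.Theory.
Local Open Scope nat_scope.
Variables (F : fieldType) (K : nat -> nat) (N C : nat).
Hypothesis K_gt0 : forall i, 0 < K i.
Hypothesis N_gt0 : 0 < N.
Local Notation n := N.+1.
Local Notation v := (is_last K).
Hypothesis balanced : forall p q, wcount v p N <= wcount v q N + C.
Local Notation j := (wcount v 0 N).

Lemma count_factor (w : nat -> bool) p : count id (factor w p N) = wcount w p N.
Proof.
rewrite -sum1_count big_mkcond big_tuple; apply: eq_bigr => i _.
by rewrite tnth_mktuple; case: (w _).
Qed.

Lemma card_near_sets :
  #|[set T : {set 'I_n} | (j <= #|T| + C) && (#|T| <= j + C)]| <= n.+1 * (n ^ C * 'C(n, j)).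
Proof.
have jN : j <= n by apply: leqW; exact: wcount_leq.
rewrite -sum1_card (partition_big (fun T : {set 'I_n} => inord #|T| : 'I_n.+1) predT) //=.
rewrite -[X in X * _](card_ord n.+1) -sum_nat_const; apply: leq_sum => k _.
have [kn|kn] := boolP ((j <= k + C) && (k <= j + C)); last first.
  rewrite big_pred0 // => T; rewrite inE; apply/negbTE; apply: contra kn => /andP[+ /eqP <-].
  by rewrite inordK // ltnS -[X in _ <= X](card_ord n) max_card.
apply: leq_trans (leq_bin_near n j k C isT jN _ _); [|by case/andP: kn|by case/andP: kn].
rewrite -[X in 'C(X, _)](card_ord n) -card_draws -sum1_card.
rewrite [X in _ <= X]big_mkcond [X in X <= _]big_mkcond; apply: leq_sum => T _.
rewrite !inE; case: ifP => // /andP[_ /eqP <-].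
by rewrite inordK ?eqxx // ltnS -[X in _ <= X](card_ord n) max_card.
Qed.

Lemma codim_upper : codim F K n <= Comp v N * (n * (n.+1 * (n ^ C * 'C(n, j)))).
Proof.
pose E : {set N.-tuple bool * 'I_n * {set 'I_n}} := setX (setX (factors v N) setT)
  [set T : {set 'I_n} | (j <= #|T| + C) && (#|T| <= j + C)].
apply: (leq_trans (codim_leq_patterns F K N N_gt0 _ (fun _ => True) E _ _)).
- by move=> f H sigma; apply: H.
- move=> sigma _ p h T _ cT _ _; rewrite !in_setX mem_factors in_setT inE cT count_factor.
  by rewrite !balanced.
by rewrite !cardsX cardsT card_ord -mulnA !leq_mul // card_near_sets.
Qed.

Lemma codim_lower : 'C(n, j) <= n * codim F K n.
Proof.
have jN := wcount_leq v 0 N.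
(* The head is kept at variable 0, so the sets come from the other [N] variables; the factor [n]
   pays for this. *)
apply: (leq_trans (n := n * 'C(N, j))).
  by rewrite (mul_bin_down n) leq_pmull // subn_gt0 ltnS.
rewrite leq_mul2l; apply/orP; right.
pose E := [set T : {set 'I_n} | T \subset ~: [set ord0] & #|T| == j].
have -> : 'C(N, j) = #|E| by rewrite cards_draws cardsC1 card_ord.
apply: (codim_geq_patterns F K N N_gt0 (@is_id F K n) (fun _ => True)) => //.
  by move=> T; rewrite inE count_factor subsetC sub1set inE => /andP[? /eqP].
Qed.

Let odd_vars k : {set 'I_n} := [set x : 'I_n | k <= x].

Let admissible k (sigma : nat -> Aelt F) : Prop :=
  (forall i, i < k -> in_A0 K (sigma i)) /\ (forall i, k <= i -> i < n -> in_A1 K (sigma i)).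

Lemma card_odd_vars k : #|odd_vars k| = n - k.
Proof.
rewrite -sum1_card; under eq_bigl => x do rewrite inE.
rewrite -(big_mkord (fun i => k <= i) (fun=> 1)) sum1_count /index_iota subn0.
case: (leqP k n) => kn; last first.
  rewrite (eq_in_count (a2 := pred0)) ?count_pred0; first lia.
  by move=> x; rewrite mem_iota /=; lia.
have -> : iota 0 n = iota 0 k ++ iota k (n - k) by rewrite -iotaD subnKC.
rewrite count_cat (eq_in_count (a2 := pred0)) ?count_pred0; last first.
  by move=> x; rewrite mem_iota /=; lia.
rewrite (eq_in_count (a2 := predT)) ?count_predT ?size_iota //.
by move=> x; rewrite mem_iota /=; lia.
Qed.

(** Even elements have no b-component and odd ones no a-component, so a nonzero weight forces [T] to
    consist of the odd variables other than the head. *)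
Lemma codim_gr_leq k (E : {set N.-tuple bool * 'I_n * {set 'I_n}}) :
  (forall p h, let T := odd_vars k :\ h in
     #|T| = wcount v p N -> (factor v p N, h, T) \in E) ->
  codim_gr F K k n <= #|E|.
Proof.
move=> HE; apply: (codim_leq_patterns F K N N_gt0 _ (admissible k)).
  by move=> f H sigma h0 h1; apply: H.
move=> sigma [even_s odd_s] p h T hT cT _ w0.
have TE : T = odd_vars k :\ h.
  apply/setP => x; rewrite in_setD1 inE; have [->|xh] := eqVneq x h; first exact: negbTE.
  have : (if x \in T then bcoef (sigma x) else acoef (sigma x)) != 0%R.
    by apply: contra w0 => /eqP e; rewrite /weight (bigD1 x) //= e mul0r.
  case: (ltnP x k) => xk /=.
    by have [-> _] := even_s _ xk; case: (x \in T) => //; rewrite eqxx.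
  by have [-> _] := odd_s _ xk (ltn_ord x); case: (x \in T) => //; rewrite eqxx.
by rewrite TE in cT *; apply: HE; rewrite cT count_factor.
Qed.

Lemma codim_gr_upper k : k <= n ->
  'C(n, k) * codim_gr F K k n <= Comp v N * n * (n ^ C.+1 * 'C(n, j)).
Proof.
move=> kn; have jN : j <= n by apply: leqW; exact: wcount_leq.
(* The head may itself be odd, whence [C.+1] in place of [C]. *)
have cardT h : n - k <= (#|odd_vars k :\ h|).+1 /\ #|odd_vars k :\ h| <= n - k.
  by have := cardsD1 h (odd_vars k); rewrite card_odd_vars; case: (h \in _); lia.
have [near|far] := boolP ((j <= n - k + C.+1) && (n - k <= j + C.+1)).
  rewrite mulnC leq_mul //; last first.
    by rewrite -bin_sub //; apply: leq_bin_near => //; case/andP: near.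
  pose E := [set (uh.1, uh.2, odd_vars k :\ uh.2) |
             uh in setX (factors v N) [set: 'I_n]].
  apply: (leq_trans (codim_gr_leq k E _)).
    move=> p h /= _; apply/imsetP; exists (factor v p N, h) => //.
    by rewrite in_setX mem_factors in_setT.
  by apply: leq_trans (leq_imset_card _ _) _; rewrite cardsX cardsT card_ord.
(* Too many or too few odd variables fit no factor, so no pattern is visible. *)
rewrite (_ : codim_gr F K k n = 0) ?muln0 //; apply/eqP; rewrite -leqn0.
apply: (leq_trans (codim_gr_leq k set0 _)); last by rewrite cards0.
move=> p h /= cT; have [c1 c2] := cardT h; rewrite cT in c1 c2.
by have := balanced p 0; have := balanced 0 p; move: far; rewrite negb_and -!ltnNge; lia.
Qed.

Lemma codim_gr_total_upper :
  codim_gr_total F K n <= n.+1 * (Comp v N * n * (n ^ C.+1 * 'C(n, j))).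
Proof.
rewrite -[X in _ <= X * _](card_ord n.+1) -sum_nat_const.
by apply: leq_sum => k _; apply: codim_gr_upper; rewrite -ltnS.
Qed.

Lemma codim_gr_total_lower : 'C(n, j) <= codim_gr_total F K n.
Proof.
have jN : j < n by rewrite ltnS wcount_leq.
(* One term suffices: with exactly [j] odd variables the binomial is the required one and the graded
   codimension is nonzero. *)
have kn : n - j < n.+1 by rewrite ltnS leq_subr.
rewrite /codim_gr_total (bigD1 (Ordinal kn)) //= bin_sub; last exact: ltnW.
apply: leq_trans (leq_addr _ _); rewrite leq_pmulr //.
have k0 : 0 < n - j by rewrite subn_gt0.
rewrite -(cards1 (odd_vars (n - j))).
apply: (codim_geq_patterns F K N N_gt0 (@is_grid F K (n - j) n) (admissible (n - j))).
- by move=> f H sigma [h0 h1]; apply: H.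
- move=> T; rewrite inE => /eqP->; rewrite inE -ltnNge k0 count_factor card_odd_vars.
  by split=> //; lia.
move=> T; rewrite inE => /eqP->; split=> [i hi|i hi iN]; split=> /=.
- by rewrite inE inordK ?(leq_trans hi) ?leq_subr // leqNgt hi.
- by move=> p; rewrite coefC; case: p => [|p] //=; rewrite block_of0.
- by rewrite inE inordK // hi.
- by move=> p _; rewrite (_ : (i == 0) = false) ?coef0 //; apply/negbTE/eqP; lia.
Qed.

End Codimensions.

(** * Growth of binomial coefficients *)

Section Entropy.

(** Expand [n ^ n] as the n-th power of (n - j) + j: the term with index [j] is the largest of the
    [n.+1] terms. *)
Lemma bin_entropy_nat n j : (j <= n)%N ->
  ('C(n, j) * ((n - j) ^ (n - j) * j ^ j) <= n ^ n <=
   n.+1 * ('C(n, j) * ((n - j) ^ (n - j) * j ^ j)))%N.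
Proof.
move=> jn; pose t i := ('C(n, i) * ((n - j) ^ (n - i) * j ^ i))%N.
have sum_t : (n ^ n = \sum_(i < n.+1) t i)%N by rewrite -Pascal subnK.
(* Neighbouring terms now compare as [(n - i) * j] with [i.+1 * (n - j)], so they increase up to [j]
   and decrease after it. *)
have step i : (i < n)%N -> (t i.+1 * i.+1 = (n - i) * j * ('C(n, i) * ((n - j) ^ (n - i.+1) * j ^ i)))%N /\
    (t i * i.+1 = i.+1 * (n - j) * ('C(n, i) * ((n - j) ^ (n - i.+1) * j ^ i)))%N.
  move=> i_n; have E := mul_bin_left n i.
  have e : (n - i = (n - i.+1).+1)%N by lia.
  rewrite /t; split; last by rewrite e expnS; move: ('C(_, _)) (expn _ _) => *; lia.
  transitivity ((i.+1 * 'C(n, i.+1)) * ((n - j) ^ (n - i.+1) * j ^ i.+1))%N; first by lia.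
  by rewrite E expnS; move: ('C(_, _)) => *; lia.
have le_t i : (i <= n)%N -> (t i <= t j)%N.
  case: (leqP i j) => ij i_n.
    rewrite -(subKn ij); elim: (j - i)%N (leq_subr i j) => [|k IH] kj; first by rewrite subn0.
    apply: leq_trans (IH _); last by lia.
    have -> : (j - k = (j - k.+1).+1)%N by lia.
    have [E1 E2] := step (j - k.+1)%N ltac:(lia).
    rewrite -(leq_pmul2r (ltn0Sn (j - k.+1)%N)) E1 E2; apply: leq_mul => //.
    by rewrite mulnC; apply: leq_mul; lia.
  rewrite -(subnKC (ltnW ij)); have : (j + (i - j) <= n)%N by lia.
  elim: (i - j)%N => [|k IH] kn; first by rewrite addn0.
  apply: leq_trans (IH _); last by lia.
  rewrite addnS; have [E1 E2] := step (j + k)%N ltac:(lia).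
  rewrite -(leq_pmul2r (ltn0Sn (j + k)%N)) E1 E2; apply: leq_mul => //.
  by rewrite mulnC; apply: leq_mul; lia.
have -> : ('C(n, j) * ((n - j) ^ (n - j) * j ^ j) = t j)%N by [].
rewrite sum_t; apply/andP; split.
  have jn1 : (j < n.+1)%N by [].
  by rewrite (bigD1 (Ordinal jn1)) //= leq_addr.
rewrite -[X in (_ <= X * _)%N](card_ord n.+1) -sum_nat_const.
by apply: leq_sum => i _; apply: le_t; rewrite -ltnS.
Qed.

Lemma INR_muln a b : INR (a * b)%N = INR a * INR b.
Proof. exact: mult_INR. Qed.

Lemma INR_expn a b : INR (a ^ b)%N = INR a ^ b.
Proof. by elim: b => // b IH; rewrite expnS INR_muln IH. Qed.

Lemma INR_leq a b : (a <= b)%N -> INR a <= INR b.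
Proof. by move=> h; apply: le_INR; lia. Qed.

Lemma INR_gt0 a : (0 < a)%N -> 0 < INR a.
Proof. by move=> h; apply: lt_0_INR; lia. Qed.

Lemma ln_leq x y : 0 < x -> x <= y -> ln x <= ln y.
Proof. by move=> x0 [h|->]; [left; apply: ln_increasing|right]. Qed.

Lemma ln_div x y : 0 < x -> 0 < y -> ln (x / y) = ln x - ln y.
Proof.
by move=> x0 y0; rewrite /Rdiv ln_mult ?ln_Rinv //; apply: Rinv_0_lt_compat.
Qed.

Lemma ln_muln a b : (0 < a)%N -> (0 < b)%N ->
  ln (INR (a * b)%N) = ln (INR a) + ln (INR b).
Proof. by move=> a0 b0; rewrite INR_muln ln_mult //; apply: INR_gt0. Qed.

Lemma ln_expn a b : (0 < a)%N -> ln (INR (a ^ b)%N) = INR b * ln (INR a).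
Proof. by move=> a0; rewrite INR_expn ln_pow //; apply: INR_gt0. Qed.

Definition entropy (x : R) : R := - x * ln x - (1 - x) * ln (1 - x).

Lemma ln_bin_entropy n j : (0 < j < n)%N ->
  INR n * entropy (INR j / INR n) - ln (INR n.+1) <= ln (INR 'C(n, j)) <=
  INR n * entropy (INR j / INR n).
Proof.
move=> /andP[j0 jn]; have jn' := ltnW jn.
have n0 : (0 < n)%N by lia.
have nj0 : (0 < n - j)%N by lia.
have [Rn Rj Rnj] := And3 (INR_gt0 _ n0) (INR_gt0 _ j0) (INR_gt0 _ nj0).
have Enj : INR (n - j)%N = INR n - INR j by apply: minus_INR; lia.
have HE : INR n * entropy (INR j / INR n) =
    INR n * ln (INR n) - (INR (n - j)%N * ln (INR (n - j)%N) + INR j * ln (INR j)).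
  rewrite /entropy.
  have -> : 1 - INR j / INR n = INR (n - j)%N / INR n by rewrite Enj; field; lra.
  rewrite !ln_div // Enj; field; lra.
have C0 : (0 < 'C(n, j))%N by rewrite bin_gt0.
have P0 : (0 < (n - j) ^ (n - j) * j ^ j)%N by rewrite muln_gt0 !expn_gt0 nj0 j0.
have /andP[/INR_leq up /INR_leq low] := bin_entropy_nat n j jn'.
have CP0 : (0 < 'C(n, j) * ((n - j) ^ (n - j) * j ^ j))%N by rewrite muln_gt0 C0.
have nn0 : (0 < n ^ n)%N by rewrite expn_gt0 n0.
have := ln_leq _ _ (INR_gt0 _ CP0) up; have := ln_leq _ _ (INR_gt0 _ nn0) low.
rewrite !ln_muln // ?expn_gt0 ?nj0 ?j0 // !ln_expn // HE; lra.
Qed.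

Lemma entropy_continuous x : 0 < x < 1 -> continuity_pt entropy x.
Proof.
move=> [x0 x1]; rewrite /entropy.
have cln y : 0 < y -> continuity_pt ln y.
  by move=> y0; apply: derivable_continuous_pt; exists (/ y); apply: derivable_pt_lim_ln.
have cid : continuity_pt id x by apply: derivable_continuous_pt; apply: derivable_pt_id.
have c1 : continuity_pt (fun y => 1 - y) x.
  by apply: continuity_pt_minus => //; apply: continuity_pt_const => ? ?.
apply: continuity_pt_minus; apply: continuity_pt_mult => //.
- exact: continuity_pt_opp.
- exact: cln.
- by apply: (continuity_pt_comp (fun y => 1 - y) ln) => //; apply: cln; lra.
Qed.

Lemma exp_entropy x : 0 < x < 1 -> exp (entropy x) = Phi x.
Proof.
move=> [x0 x1]; rewrite /Phi /xpow_negx.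
case: Req_EM_T => h; first lra.
case: Req_EM_T => h'; first lra.
by rewrite /Rpower -exp_plus /entropy; congr exp; lra.
Qed.

Lemma Rabs_div_pos a b : 0 < b -> Rabs (a / b) = Rabs a / b.
Proof. by move=> b0; rewrite /Rdiv Rabs_mult Rabs_inv (Rabs_pos_eq b) //; lra. Qed.

Lemma cv_const_over_n c : Un_cv (fun n => c / INR n) 0.
Proof.
move=> e e0; have [M hM] := INR_unbounded (Rabs c / e).
exists M.+1 => n hn; rewrite /R_dist Rminus_0_r.
have n0 : 0 < INR n by apply: lt_0_INR; lia.
rewrite Rabs_div_pos //; apply: (Rmult_lt_reg_r (INR n)) => //.
have -> : Rabs c / INR n * INR n = Rabs c / e * e by field; lra.
rewrite (Rmult_comm e); apply: Rmult_lt_compat_r => //.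
by have : INR M <= INR n by [apply: le_INR; lia]; lra.
Qed.

Lemma cv_ln_over_n a b : Un_cv (fun n => (a + b * ln (INR n.+1)) / INR n) 0.
Proof.
suff cvl : Un_cv (fun n => ln (INR n.+1) / INR n) 0.
  have cvb : Un_cv (fun=> b) b by move=> e e0; exists O => n _; rewrite R_dist_eq.
  have := CV_plus _ _ _ _ (cv_const_over_n a) (CV_mult _ _ _ _ cvb cvl).
  rewrite Rmult_0_r Rplus_0_r; apply: Un_cv_ext => n.
  by rewrite /Rdiv; ring.
(* The inequality ln y <= y - 1 at y = d(n+1) bounds ln(n+1) by dn plus the constant d - 1 - ln
   d. *)
move=> e e0; set d := e / 2; have d0 : 0 < d by rewrite /d; lra.
have [M hM] := cv_const_over_n (d - 1 - ln d) d d0.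
exists M.+1 => n hn; have := hM n ltac:(lia); rewrite /R_dist !Rminus_0_r => h.
have n0 : 0 < INR n by apply: lt_0_INR; lia.
have n1 : 1 <= INR n by apply: (le_INR 1); lia.
have ln0 : 0 <= ln (INR n.+1) by rewrite -ln_1; apply: ln_leq; rewrite ?S_INR; lra.
rewrite Rabs_pos_eq; last by apply: Rle_mult_inv_pos.
have : ln (INR n.+1) <= d * INR n.+1 - 1 - ln d.
  have Sn0 : 0 < INR n.+1 by apply: INR_gt0.
  have : ln (d * INR n.+1) <= d * INR n.+1 - 1.
    have p : 0 < d * INR n.+1 by apply: Rmult_lt_0_compat.
    by have := exp_ineq1_le (ln (d * INR n.+1)); rewrite exp_ln //; lra.
  by rewrite ln_mult //; lra.
rewrite S_INR => h1.
have : ln (INR n + 1) / INR n <= d + (d - 1 - ln d) / INR n.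
  apply: (Rmult_le_reg_r (INR n)) => //.
  have -> : (d + (d - 1 - ln d) / INR n) * INR n = d * INR n + (d - 1 - ln d) by field; lra.
  have -> : ln (INR n + 1) / INR n * INR n = ln (INR n + 1) by field; lra.
  lra.
have := Rle_abs ((d - 1 - ln d) / INR n); rewrite /d in h *; lra.
Qed.

(** A polynomial factor changes the logarithm of the n-th root by O(ln n / n) only, so the limit is
    governed by the entropy of [j n / n]. *)
Lemma cv_nroot_bin (c j : nat -> nat) (A D : nat) (x : R) :
  0 < x < 1 -> Un_cv (fun n => INR (j n) / INR n) x ->
  (exists n0, forall n, (n0 <= n)%N ->
     ('C(n, j n) <= A * n.+1 ^ D * c n)%N /\ (c n <= A * n.+1 ^ D * 'C(n, j n))%N) ->
  Un_cv (fun n => nroot (c n) n) (Phi x).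
Proof.
move=> x01 jx [n0 hc].
have Hj := continuity_seq _ _ _ (entropy_continuous x x01) jx.
have [n1 hn1] : exists n1, forall n, (n1 <= n)%N -> (0 < j n < n)%N.
  have [n1 h1] := jx (Rmin x (1 - x)) ltac:(apply: Rmin_glb_lt; lra).
  exists n1.+1 => n hn; have := h1 n ltac:(lia); rewrite /R_dist => /Rabs_def2[ha hb].
  have := Rmin_l x (1 - x); have := Rmin_r x (1 - x) => r1 r2.
  have n_0 : 0 < INR n by apply: lt_0_INR; lia.
  apply/andP; split.
    rewrite lt0n; apply/eqP => j0; move: hb; rewrite j0 /= /Rdiv Rmult_0_l; lra.
  apply/ltP/INR_lt; apply: (Rmult_lt_reg_r (/ INR n)); first exact: Rinv_0_lt_compat.
  rewrite Rinv_r; last lra.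
  by move: ha; rewrite /Rdiv; lra.
(* The [+ 1] accounts for the lower entropy bound, which loses one ln(n+1). *)
pose err n := (ln (INR A) + (INR D + 1) * ln (INR n.+1)) / INR n.
have bound n : (maxn n0 n1 < n)%N ->
    nroot (c n) n = exp (ln (INR (c n)) / INR n) /\
    Rabs (ln (INR (c n)) / INR n - entropy (INR (j n) / INR n)) <= err n.
  rewrite gtn_max => /andP[/ltnW /hc[h1 h2] /ltnW/hn1 hj].
  have n_0 : (0 < n)%N by lia.
  have Rn := INR_gt0 _ n_0.
  have C0 : (0 < 'C(n, j n))%N by rewrite bin_gt0; lia.
  (* A positive binomial coefficient makes [c n] positive, which excludes the default value of
     [nroot]. *)
  have := leq_trans C0 h1; rewrite !muln_gt0 => /andP[/andP[A0 P0] c0].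
  split.
    by rewrite /nroot; case: eqP => [c00|_]; [rewrite c00 in c0 | rewrite /Rpower /Rdiv Rmult_comm].
  have [B1 B2] := ln_bin_entropy n (j n) hj.
  have := ln_leq _ _ (INR_gt0 _ C0) (INR_leq _ _ h1).
  have := ln_leq _ _ (INR_gt0 _ c0) (INR_leq _ _ h2).
  rewrite !ln_muln ?muln_gt0 ?A0 ?P0 // !ln_expn // => l2 l1.
  have S0 : 0 <= ln (INR n.+1).
    by rewrite -ln_1; apply: ln_leq; rewrite ?S_INR; lra.
  have -> : ln (INR (c n)) / INR n - entropy (INR (j n) / INR n) =
      (ln (INR (c n)) - INR n * entropy (INR (j n) / INR n)) / INR n by field; lra.
  rewrite Rabs_div_pos //.
  apply: Rmult_le_compat_r; first by left; apply: Rinv_0_lt_compat.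
  by apply: Rabs_le; lra.
have cvc : Un_cv (fun n => ln (INR (c n)) / INR n) (entropy x).
  move=> e e0; have [m1 h1] := Hj (e / 2) ltac:(lra).
  have [m2 h2] := cv_ln_over_n (ln (INR A)) (INR D + 1) (e / 2) ltac:(lra).
  exists (maxn (maxn n0 n1).+1 (maxn m1 m2)) => n hn.
  have [_ b] := bound n ltac:(lia).
  have := h1 n ltac:(lia); have := h2 n ltac:(lia).
  rewrite /R_dist Rminus_0_r -/(err n) => e2 e1.
  have := Rle_abs (err n).
  have := Rabs_triang (ln (INR (c n)) / INR n - entropy (INR (j n) / INR n))
    (entropy (INR (j n) / INR n) - entropy x).
  have -> : ln (INR (c n)) / INR n - entropy (INR (j n) / INR n) +
    (entropy (INR (j n) / INR n) - entropy x) = ln (INR (c n)) / INR n - entropy x by ring.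
  lra.
have cvexp : Un_cv (fun n => exp (ln (INR (c n)) / INR n)) (exp (entropy x)).
  by apply: continuity_seq cvc; apply: derivable_continuous_pt; apply: derivable_pt_exp.
rewrite -exp_entropy // => e e0; have [m1 h1] := cvexp e e0.
exists (maxn (maxn n0 n1).+1 m1) => n hn.
by have [-> _] := bound n ltac:(lia); apply: h1; lia.
Qed.

End Entropy.

(** * Density of block ends *)

Section Density.
Variables (w : nat -> bool) (alpha : R).
Hypothesis slope_w : slope_is w alpha.

Lemma slope_ge0 : 0 <= alpha.
Proof.
apply: Rnot_lt_le => a0; have [M hM] := slope_w (- alpha) ltac:(lra).
have := hM M.+1 ltac:(lia); rewrite /R_dist => /Rabs_def2[h _]; move: h.
have : 0 <= INR (\sum_(i < M.+1) w i) / INR M.+1.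
  by apply: Rle_mult_inv_pos; [exact: pos_INR | exact: INR_gt0].
lra.
Qed.

(** Convergence controls large [t]; the finitely many small ones are absorbed into [M], so the bound
    holds at every [t]. *)
Lemma slope_deviation e : 0 < e ->
  exists M, forall t, Rabs (INR (wcount w 0 t) - alpha * INR t) <= e * INR t + M.
Proof.
move=> e0; have [T hT] := slope_w e e0; have a0 := slope_ge0.
exists ((1 + alpha) * INR T) => t; have t0 := pos_INR t.
have et : 0 <= e * INR t by apply: Rmult_le_pos; lra.
case: (leqP T t) => hTt.
  have M0 : 0 <= (1 + alpha) * INR T by apply: Rmult_le_pos; [lra | exact: pos_INR].
  case: t t0 et hTt => [|t] t0 et hTt.
    by rewrite wcount0 /= Rmult_0_r Rminus_0_r Rabs_R0; move: et; rewrite /=; lra.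
  have := hT t.+1 ltac:(lia); rewrite /R_dist.
  have Rt : 0 < INR t.+1 by apply: INR_gt0.
  have -> : (\sum_(i < t.+1) w i = wcount w 0 t.+1)%N by [].
  have -> : INR (wcount w 0 t.+1) / INR t.+1 - alpha =
      (INR (wcount w 0 t.+1) - alpha * INR t.+1) / INR t.+1 by field; lra.
  rewrite Rabs_div_pos // => /(Rmult_lt_compat_r _ _ _ Rt).
  by rewrite /Rdiv Rmult_assoc Rinv_l; lra.
have := INR_leq _ _ (wcount_leq w 0 t); have := pos_INR (wcount w 0 t) => s0 st.
have tT : INR t <= INR T by apply/INR_leq/ltnW.
have : 0 <= alpha * INR t by apply: Rmult_le_pos.
have : alpha * INR t <= alpha * INR T by apply: Rmult_le_compat_l.
by move=> h1 h2; apply: Rabs_le; lra.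
Qed.

Variable m : nat.
Hypothesis m_ge2 : (2 <= m)%N.
Local Notation K := (Kmw m w).

(** The count t of block ends before a position is the index of its block, so mt plus the ones among
    the first t letters of [w], about alpha t of them, gives the position up to one block. *)
Lemma block_density :
  Un_cv (fun n => INR (wcount (is_last K) 0 n.-1) / INR n) (/ (INR m + alpha)).
Proof.
have a0 := slope_ge0; have m2 : 2 <= INR m by apply: (INR_leq 2).
move=> e e0; have [M hM] := slope_deviation (e / 2) ltac:(lra).
have M0 : 0 <= M by have := hM O; have := Rabs_pos (INR (wcount w 0 0) - alpha * INR 0); rewrite /=; lra.
(* The constant collects the deviation [M], one block length and off-by-one terms. *)
have [n0 hn0] := cv_const_over_n (M + INR m + 3 + e) (e / 2) ltac:(lra).
exists n0.+1 => -[|n] hn; first by lia.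
have := hn0 n.+1 ltac:(lia); rewrite /R_dist Rminus_0_r => /(Rle_lt_trans _ _ _ (Rle_abs _)).
have Rn : 0 < INR n.+1 by apply: INR_gt0.
set t := wcount _ _ _.
have tE : block_of K n = t.
  by rewrite -[n]add0n -wcount_is_last ?block_of0 ?add0n //; exact: Kmw_gt0.
have := block_of_bounds K (Kmw_gt0 m w m_ge2) n; rewrite tE.
have startE s : (bstart K s = m * s + wcount w 0 s)%N.
  by rewrite -{1}[s]add0n bstart_Kmw // bstart0.
rewrite !startE => /andP[low up].
have {}low := INR_leq _ _ low; have {}up := INR_leq _ _ up.
rewrite wcountSr mulnS !plus_INR !INR_muln in low up.
have tn : INR t <= INR n.+1.
  by apply: INR_leq; apply: leqW; rewrite /t; exact: wcount_leq.
have wt : INR (w (0 + t)%N) <= 1 by apply: (INR_leq _ 1); case: (w _).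
have [d1 d2] : - (e / 2 * INR t + M) <= INR (wcount w 0 t) - alpha * INR t <= e / 2 * INR t + M.
  have := hM t; have := Rle_abs (INR (wcount w 0 t) - alpha * INR t).
  have := Rle_abs (- (INR (wcount w 0 t) - alpha * INR t)); rewrite Rabs_Ropp; lra.
rewrite S_INR in tn Rn up *; rewrite -S_INR in Rn *; rewrite S_INR.
move=> hn0'.
have Rn1 : 0 < INR n + 1 by rewrite -S_INR.
have mu0 : 1 <= INR m + alpha by lra.
have -> : INR t / (INR n + 1) - / (INR m + alpha) =
   (((INR m + alpha) * INR t - (INR n + 1)) / (INR m + alpha)) / (INR n + 1) by field; lra.
rewrite !Rabs_div_pos //; last lra.
apply: (Rmult_lt_reg_r (INR n + 1)) => //.
rewrite /Rdiv Rmult_assoc Rinv_l ?Rmult_1_r; last lra.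
have num : Rabs ((INR m + alpha) * INR t - (INR n + 1)) <= e / 2 * (INR n + 1) + (M + INR m + 3).
  have : e / 2 * INR t <= e / 2 * (INR n + 1) by apply: Rmult_le_compat_l; lra.
  by move=> h; apply: Rabs_le; lra.
have : Rabs ((INR m + alpha) * INR t - (INR n + 1)) * / (INR m + alpha) <=
    Rabs ((INR m + alpha) * INR t - (INR n + 1)).
  rewrite -[X in _ <= X]Rmult_1_r; apply: Rmult_le_compat_l; first exact: Rabs_pos.
  by rewrite -Rinv_1; apply: Rinv_le_contravar; lra.
have : (M + INR m + 3 + e) < e / 2 * (INR n + 1).
  move: hn0' => /(Rmult_lt_compat_r _ _ _ Rn1).
  by rewrite /Rdiv Rmult_assoc Rinv_l; lra.
lra.
Qed.

End Density.

(** * Both exponents from the common binomial estimate *)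

Lemma leq_expn2r_mono a b c : (a <= b -> a ^ c <= b ^ c)%N.
Proof. by move=> ab; case: c => // c; rewrite leq_exp2r. Qed.

Theorem theorem3 (F : fieldType) (charF0 : [pchar F]%R =i pred0)
  (m : nat) (w : nat -> bool) (alpha : R) :
  (2 <= m)%N -> (periodic w \/ sturmian w) -> slope_is w alpha ->
  Un_cv (fun n => nroot (codim_gr_total F (Kmw m w) n) n)
        (Phi (/ (INR m + alpha))%R) /\
  Un_cv (fun n => nroot (codim F (Kmw m w) n) n)
        (Phi (/ (INR m + alpha))%R).
Proof.
move=> m_ge2 ww slope_w.
have [Cw [bal_w Comp_w]] := low_complexity_word w ww.
have a0 := slope_ge0 w alpha slope_w.
have m2 : 2 <= INR m by apply: (INR_leq 2).
have x01 : 0 < / (INR m + alpha) < 1.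
  split; first by apply: Rinv_0_lt_compat; lra.
  by rewrite -Rinv_1; apply: Rinv_lt_contravar; lra.
have K0 := Kmw_gt0 m w m_ge2.
(* [D] bounds the discrepancy of the word of block ends; the successor keeps [A] positive. *)
pose D := (Cw + m.+1)%N; pose A := (m.+1 * Cw).+1.
have bal N p q := is_last_balanced m w m_ge2 Cw bal_w N p q.
have CompE N : (Comp (is_last (Kmw m w)) N <= A * N.+1)%N.
  apply: leq_trans (Comp_is_last m w m_ge2 N) _.
  by apply: leq_trans (leq_mul (leqnn m.+1) (Comp_w N)) _; rewrite mulnA leq_mul // /A.
have dens := block_density w alpha slope_w m m_ge2.
have le_pow N c e : (c <= D + 4)%N -> (N.+1 ^ c * e <= A * N.+2 ^ (D + 4) * e)%N.
  move=> hc; rewrite leq_mul2r; apply/orP; right.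
  apply: (leq_trans (n := N.+2 ^ c)%N); first by rewrite leq_expn2r_mono.
  by apply: leq_trans (leq_pmull _ _) => //; rewrite leq_pexp2l.
(* Three linear factors join a power with exponent at most [D.+1], whence [D + 4]. *)
have up3 N c b : (c <= D.+1)%N ->
    (A * N.+1 * (N.+1 * (N.+2 * (N.+1 ^ c * b))) <= A * N.+2 ^ (D + 4) * b)%N.
  move=> hc.
  apply: (leq_trans (n := (A * N.+2 * (N.+2 * (N.+2 * (N.+2 ^ c * b)))))%N).
    by rewrite !leq_mul // leq_expn2r_mono.
  have -> : (A * N.+2 * (N.+2 * (N.+2 * (N.+2 ^ c * b))) = A * N.+2 ^ c.+3 * b)%N.
    by rewrite !expnS; lia.
  by rewrite leq_mul2r leq_mul2l leq_pexp2l ?orbT //; lia.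
have cv := cv_nroot_bin _ (fun n => wcount (is_last (Kmw m w)) 0 n.-1) A (D + 4)%N _ x01 dens.
(* The degree is [N.+1], with [N] right factors; starting at 2 makes [N] positive. *)
split; apply: cv; exists 2%N => -[|N] // hN; have N0 : (0 < N)%N by lia.
  split.
    apply: leq_trans (codim_gr_total_lower F _ N K0 N0) _.
    by have := le_pow N 0%N (codim_gr_total F (Kmw m w) N.+1) isT; rewrite mul1n.
  apply: leq_trans (codim_gr_total_upper F _ N D N0 (bal N)) _.
  apply: leq_trans (up3 N D.+1 _ (leqnn _)).
  by rewrite mulnCA -mulnA; apply: leq_mul; first exact: CompE.
split.
  apply: leq_trans (codim_lower F _ N N0) _.
  by have := le_pow N 1%N (codim F (Kmw m w) N.+1); rewrite expn1; apply; lia.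
apply: leq_trans (codim_upper F _ N D N0 (bal N)) _.
by apply: leq_trans (up3 N D _ (leqnSn _)); apply: leq_mul.
Qed.
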